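(* The map $c:\mathcal M\to\mathcal W_{ptW}$, $A\mapsto c_A$, is a Brouwer algebra embedding of the Medvedev Brouwer algebra $(\mathcal M,\le_M,\otimes,\oplus,\to,\mathbb{N}^\mathbb{N},\emptyset)$ into $(\mathcal W_{ptW},\le_{ptW},\widehat{\overline{\sqcap}},\sqcup,\Rrightarrow,1,\infty)$; i.e., it is injective, satisfies $A\le_M B\iff c_A\le_{ptW}c_B$, and maps $A\otimes B$, $A\oplus B$, $B\to A$, $\mathbb{N}^\mathbb{N}$, $\emptyset$ to (the degrees of) $c_A\,\widehat{\overline{\sqcap}}\,c_B$, $c_A\sqcup c_B$, $c_B\Rrightarrow c_A$, $1$, $\infty$ respectively.
   Context: Medvedev: for $A,B\subseteq\mathbb{N}^\mathbb{N}$, $A\le_M B$ iff there is a computable $F:\subseteq\mathbb{N}^\mathbb{N}\to\mathbb{N}^\mathbb{N}$ with $B\subseteq\mathrm{dom}(F)$ and $F(B)\subseteq A$; $\mathcal M$ is the set of degrees. $A\otimes B:=\{0p:p\in A\}\cup\{1p:p\in B\}$, $A\oplus B:=\{\langle p,q\rangle:p\in A,q\in B\}$, $B\to A:=\{\langle n,q\rangle:(\forall p\in B)\,\varphi_n\langle q,p\rangle\in A\}$, where $\langle p,q\rangle(2n)=p(n)$, $\langle p,q\rangle(2n+1)=q(n)$, $\varphi$ is a G\''odel numbering of partial computable functions $\subseteq\mathbb{N}^\mathbb{N}\to\mathbb{N}^\mathbb{N}$ (utm, smn), and $\langle n,q\rangle$ a standard encoding. Problems are partial multi-valued maps between represented spaces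 (sets with surjective partial $\delta_X:\subseteq\mathbb{N}^\mathbb{N}\to X$); $F$ realizes $f$ if $\delta_YF(p)\in f(\delta_X(p))$ for $p\in\mathrm{dom}(f\circ\delta_X)$; $f\le_W g$ iff there are computable $H,K$ with $p\mapsto H\langle p,GK(p)\rangle$ realizing $f$ for every realizer $G$ of $g$. A top $\infty$ is adjoined ($f\le_W\infty$, $\infty\le_W f$ only if $f=\infty$; $f\sqcup\infty=\infty$, $f\sqcap\infty=f$, $\overline\infty=\widehat\infty=\infty$). $c_A:\mathbb{N}^\mathbb{N}\rightrightarrows\mathbb{N}^\mathbb{N}$, $p\mapsto A$ for $A\neq\emptyset$, $c_\emptyset=\infty$. Completion: $p-1$ is the concatenation of $p(0)-1,p(1)-1,\dots$ ($0-1$ empty); $\delta^\wp_X(p)=\delta_X(p-1)$ if $p-1\in\mathrm{dom}(\delta_X)$; $\overline X=X\cup\{\bot\}$ with $\delta_{\overline X}(p)=\delta^\wp_X(p)$ if defined, $\bot$ otherwise; $\overline f(x)=f(x)$ on $\mathrm{dom}(f)$, $\overline Y$ otherwise. $\widehat f((x_n)_n)=\prod_if(x_i)$ on $\mathrm{dom}(f)^\mathbb{N}$. $f\sqcup g$: $(0,x)\mapsto\{0\}\times f(x)$, $(1,u)\mapsto\{1\}\times g(u)$; $(f\sqcap g)(x,u)=f(x)\sqcup g(u)$. Multiplicative implication (with $f^r=\delta_Y^{-1}f\delta_X$, multi-valued composition): $(g\twoheadrightarrow f)(p)=\{\langle n,k,q\rangle:\emptyset\ne\varphi_n\langle q,g^r\circ\varphi_k(p)\rangle\subseteq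 f^r(p)\}$ for $f,g\neq\infty$ with $\mathrm{dom}(g)\ne\emptyset$ or $\mathrm{dom}(f)=\emptyset$; $(g\twoheadrightarrow0)=0$, $(0\twoheadrightarrow f)=\infty$ for $f\not\equiv_W0$, $(\infty\twoheadrightarrow f)=0$, $(g\twoheadrightarrow\infty)=\infty$ for $g\ne\infty$. $f\le_{ptW}g:\iff f\le_W\widehat{\overline g}$; $\mathcal W_{ptW}$ its degrees including $\infty$; $1$ the degree of $\mathrm{id}$; $f\,\widehat{\overline\sqcap}\,g:=\widehat{\overline f}\sqcap\widehat{\overline g}$; $(g\Rrightarrow f):=(\widehat{\overline g}\twoheadrightarrow\widehat{\overline f})$. A Brouwer algebra embedding is an injective map, monotone in both directions, preserving infima, suprema, implication, bottom and top. *)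

(* Defs.v *)
From Stdlib Require Import Arith List Lia Classical ClassicalEpsilon
  FunctionalExtensionality.
From Stdlib Require Cantor.
Import ListNotations.

(** * Baire space *)

Definition baire : Type := nat -> nat.

Definition scons (n : nat) (p : baire) : baire :=
  fun i => match i with 0 => n | S j => p j end.

Definition stail (p : baire) : baire := fun i => p (S i).

Definition spair (p q : baire) : baire :=
  fun i => if Nat.even i then p (Nat.div2 i) else q (Nat.div2 i).

Definition sfst (r : baire) : baire := fun i => r (2 * i).
Definition ssnd (r : baire) : baire := fun i => r (2 * i + 1).

(** [sproj i] inverts the countable tupling
    [<p_0, p_1, ...> (<i, j>) = p_i j], with Cantor's pairing on [nat]. *)
Definition sproj (i : nat) (r : baire) : baire :=
  fun j => r (Cantor.to_nat (i, j)).

Lemma sfst_spair p q : sfst (spair p q) = p.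
Proof.
  extensionality i. unfold sfst, spair.
  rewrite Nat.even_mul. cbn [Nat.even orb]. now rewrite Nat.div2_double.
Qed.

Lemma ssnd_spair p q : ssnd (spair p q) = q.
Proof.
  extensionality i. unfold ssnd, spair.
  replace (2 * i + 1) with (S (2 * i)) by lia.
  rewrite Nat.even_succ, Nat.odd_mul. cbn [Nat.odd Nat.even negb andb].
  now rewrite Nat.div2_succ_double.
Qed.

(** * Partial functions and computability on Baire space *)

Record pfun : Type := Pfun {
  graph :> baire -> baire -> Prop;
  graph_functional : forall p q q', graph p q -> graph p q' -> q = q'
}.

Definition pdom (F : pfun) (p : baire) : Prop := exists q, F p q.

(** Programs for the partial recursive functions relative to an oracle, as
    unary functions on [nat], several arguments being packed with Cantor's
    pairing. *)
Inductive code : Type :=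
| czero | csucc | cleft | cright | coracle
| cpair (f g : code)
| ccomp (f g : code)
| cprec (f g : code)
| cmu (f : code).

(** Primitive recursion on partial functions given by their graphs:
    [h <a, 0> = f a] and [h <a, b + 1> = g <a, <b, h <a, b>>>]. *)
Fixpoint prec_graph (f g : nat -> nat -> Prop) (a b v : nat) : Prop :=
  match b with
  | 0 => f a v
  | S b' => exists w, prec_graph f g a b' w /\
      g (Cantor.to_nat (a, Cantor.to_nat (b', w))) v
  end.

(** [eval o c n m]: program [c] with oracle [o] halts on [n] with result [m]. *)
Fixpoint eval (o : baire) (c : code) (n m : nat) : Prop :=
  match c with
  | czero => m = 0
  | csucc => m = S n
  | cleft => m = fst (Cantor.of_nat n)
  | cright => m = snd (Cantor.of_nat n)
  | coracle => m = o n
  | cpair f g => exists a b,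
      eval o f n a /\ eval o g n b /\ m = Cantor.to_nat (a, b)
  | ccomp f g => exists a, eval o g n a /\ eval o f a m
  | cprec f g =>
      prec_graph (eval o f) (eval o g)
        (fst (Cantor.of_nat n)) (snd (Cantor.of_nat n)) m
  | cmu f => eval o f (Cantor.to_nat (n, m)) 0 /\
      forall j, j < m -> exists v, eval o f (Cantor.to_nat (n, j)) (S v)
  end.

Lemma eval_functional o c :
  forall n m m', eval o c n m -> eval o c n m' -> m = m'.
Proof.
  induction c as [| | | | |f IHf g IHg|f IHf g IHg|f IHf g IHg|f IHf];
    simpl; intros n m m' H H'; try congruence.
  - destruct H as (a & b & Ha & Hb & ->), H' as (a' & b' & Ha' & Hb' & ->).
    now rewrite (IHf _ _ _ Ha Ha'), (IHg _ _ _ Hb Hb').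
  - destruct H as (a & Ha & H), H' as (a' & Ha' & H').
    rewrite (IHg _ _ _ Ha Ha') in H. eauto.
  - revert m m' H H'. generalize (fst (Cantor.of_nat n)) as a.
    induction (snd (Cantor.of_nat n)) as [|b IHb]; simpl; intros a m m' H H'.
    + eauto.
    + destruct H as (w & Hw & H), H' as (w' & Hw' & H').
      rewrite (IHb _ _ _ Hw Hw') in H. eauto.
  - destruct H as [H1 H2], H' as [H1' H2'].
    destruct (lt_eq_lt_dec m m') as [[L|E]|L]; [|exact E|].
    + destruct (H2' _ L) as [v Hv]. discriminate (IHf _ _ _ H1 Hv).
    + destruct (H2 _ L) as [v Hv]. discriminate (IHf _ _ _ H1' Hv).
Qed.

(** The partial functional computed by a program, with its natural domain. *)
Definition computed (e : code) : pfun.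
Proof.
  refine (Pfun (fun p q => forall i, eval p e i (q i)) _).
  intros p q q' H H'. extensionality i. exact (eval_functional _ _ _ _ _ (H i) (H' i)).
Defined.

(** The program may also converge outside the domain of [F]. *)
Definition computable (F : pfun) : Prop :=
  exists e, forall p q, F p q -> computed e p q.

Definition computable_nat (s : nat -> nat) : Prop :=
  exists e, forall o n, eval o e n (s n).

Definition pfun_eq (F G : pfun) : Prop := forall p q, F p q <-> G p q.

Record goedel_numbering (phi : nat -> pfun) : Prop := {
  gn_sound : forall n, exists e, pfun_eq (phi n) (computed e);
  gn_complete : forall e, exists n, pfun_eq (phi n) (computed e);
  gn_utm : exists u, forall n p q,
    phi n p q <-> computed u (scons n p) q;
  gn_smn : forall e, exists s, computable_nat s /\
    forall n p q, phi (s n) p q <-> computed e (scons n p) q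
}.

(** * Medvedev reducibility *)

Definition med_le (A B : baire -> Prop) : Prop :=
  exists F : pfun, computable F /\
    (forall p, B p -> pdom F p) /\
    (forall p q, B p -> F p q -> A q).

Definition med_otimes (A B : baire -> Prop) : baire -> Prop :=
  fun r => (exists p, A p /\ r = scons 0 p) \/ (exists p, B p /\ r = scons 1 p).

Definition med_oplus (A B : baire -> Prop) : baire -> Prop :=
  fun r => exists p q, A p /\ B q /\ r = spair p q.

(** [med_imp phi B A] is [B -> A]; the pair [<n, q>] is [scons n q]. *)
Definition med_imp (phi : nat -> pfun) (B A : baire -> Prop) : baire -> Prop :=
  fun r => exists n q, r = scons n q /\
    forall p, B p -> exists s, phi n (spair q p) s /\ A s.

(** * Represented spaces *)

Record repspace : Type := Repspace {
  carrier :> Type;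
  rep : baire -> carrier -> Prop;
  rep_functional : forall p x y, rep p x -> rep p y -> x = y;
  rep_surjective : forall x, exists p, rep p x
}.
Arguments rep {r}.

Definition baire_space : repspace.
Proof.
  refine (Repspace baire (fun p x => p = x) _ _).
  - congruence.
  - intros x. now exists x.
Defined.

Definition prod_space (X Y : repspace) : repspace.
Proof.
  refine (Repspace (X * Y)
    (fun r z => rep (sfst r) (fst z) /\ rep (ssnd r) (snd z)) _ _).
  - intros r [x y] [x' y'] [H1 H2] [H1' H2']; simpl in *.
    f_equal; eapply rep_functional; eauto.
  - intros [x y]. destruct (rep_surjective X x) as [p Hp], (rep_surjective Y y) as [q Hq].
    exists (spair p q). rewrite sfst_spair, ssnd_spair. auto.
Defined.

Definition sum_space (X Y : repspace) : repspace.
Proof.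
  refine (Repspace (X + Y)
    (fun r z => match z with
                | inl x => r 0 = 0 /\ rep (stail r) x
                | inr y => r 0 = 1 /\ rep (stail r) y
                end) _ _).
  - intros r [x|y] [x'|y'] [H1 H2] [H1' H2']; try congruence;
      f_equal; eapply rep_functional; eauto.
  - intros [x|y].
    + destruct (rep_surjective X x) as [p Hp]. now exists (scons 0 p).
    + destruct (rep_surjective Y y) as [p Hp]. now exists (scons 1 p).
Defined.

Definition seq_space (X : repspace) : repspace.
Proof.
  refine (Repspace (nat -> X) (fun r x => forall i, rep (sproj i r) (x i)) _ _).
  - intros r x y H H'. extensionality i. eapply rep_functional; eauto.
  - intros x.
    pose (c := fun i => constructive_indefinite_description _ (rep_surjective X (x i))).
    exists (fun k => proj1_sig (c (fst (Cantor.of_nat k))) (snd (Cantor.of_nat k))).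
    intros i.
    replace (sproj i _) with (proj1_sig (c i)) by
      (extensionality j; unfold sproj; now rewrite Cantor.cancel_of_to).
    exact (proj2_sig (c i)).
Defined.

(** The finite word obtained by concatenating [p 0 - 1, ..., p (k - 1) - 1],
    where [0 - 1] is the empty word. *)
Definition dec_word (p : baire) (k : nat) : list nat :=
  flat_map (fun i => match p i with 0 => [] | S m => [m] end) (seq 0 k).

(** [dec p q]: the concatenation [p - 1] is infinite and equals [q]. *)
Definition dec (p q : baire) : Prop :=
  (forall k, dec_word p k = map q (seq 0 (length (dec_word p k)))) /\
  (forall m, exists k, m < length (dec_word p k)).

Lemma dec_functional p q q' : dec p q -> dec p q' -> q = q'.
Proof.
  intros [H1 H2] [H1' _]. extensionality m. destruct (H2 m) as [k Hk].
  pose proof (eq_trans (eq_sym (H1 k)) (H1' k)) as E.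
  apply (f_equal (fun l => nth_error l m)) in E.
  rewrite !nth_error_map, nth_error_seq in E.
  apply Nat.ltb_lt in Hk. rewrite Hk in E. simpl in E. congruence.
Qed.

Lemma dec_succ p : dec (fun i => S (p i)) p.
Proof.
  assert (E : forall k, dec_word (fun i => S (p i)) k = map p (seq 0 k)).
  { intros k. unfold dec_word.
    induction (seq 0 k) as [|a l IH]; simpl; congruence. }
  split.
  - intros k. now rewrite E, length_map, length_seq.
  - intros m. exists (S m). rewrite E, length_map, length_seq. lia.
Qed.

Definition precomp_rep (X : repspace) (p : baire) (x : X) : Prop :=
  exists q, dec p q /\ rep q x.

(** The completion of [X], with [None] in the role of the bottom element. *)
Definition completion (X : repspace) : repspace.
Proof.
  refine (Repspace (option X)
    (fun p z => match z with
                | Some x => precomp_rep X p x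
                | None => ~ exists x, precomp_rep X p x
                end) _ _).
  - intros p [x|] [y|] H H'; try (exfalso; eauto; fail); auto.
    destruct H as (q & D & Hq), H' as (q' & D' & Hq').
    rewrite (dec_functional _ _ _ D D') in Hq.
    f_equal. eapply rep_functional; eauto.
  - intros [x|].
    + destruct (rep_surjective X x) as [p Hp].
      exists (fun i => S (p i)), p. split; auto using dec_succ.
    + exists (fun _ => 0). intros (x & q & [_ D] & _).
      destruct (D 0) as [k Hk]. revert Hk. unfold dec_word.
      induction (seq 0 k) as [|a l IH]; simpl; [lia|exact IH].
Defined.

(** * Problems and Weihrauch reducibility *)

(** A partial multi-valued map is given by its graph; its domain consists of
    the points with a nonempty set of values. *)
Definition mdom {X Y : Type} (f : X -> Y -> Prop) (x : X) : Prop :=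
  exists y, f x y.

Definition mcomp {X Y Z : Type} (g : Y -> Z -> Prop) (f : X -> Y -> Prop) :
  X -> Z -> Prop :=
  fun x z => (forall y, f x y -> mdom g y) /\ exists y, f x y /\ g y z.

Record mvmap : Type := Mvmap {
  src : repspace;
  tgt : repspace;
  mv :> src -> tgt -> Prop
}.

Inductive problem : Type :=
| Prob (f : mvmap)
| Top.

Definition realizes (F : pfun) (f : mvmap) : Prop :=
  forall p x, rep p x -> mdom f x ->
    exists q y, F p q /\ rep q y /\ f x y.

(** [p |-> H <p, G (K p)>] *)
Definition wcompose (H K G : pfun) : pfun.
Proof.
  refine (Pfun (fun p s => exists k g, K p k /\ G k g /\ H (spair p g) s) _).
  intros p s s' (k & g & Hk & Hg & Hs) (k' & g' & Hk' & Hg' & Hs').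
  rewrite (graph_functional _ _ _ _ Hk Hk') in Hg.
  rewrite (graph_functional _ _ _ _ Hg Hg') in Hs.
  exact (graph_functional _ _ _ _ Hs Hs').
Defined.

Definition w_le (f g : problem) : Prop :=
  match f, g with
  | _, Top => True
  | Top, Prob _ => False
  | Prob f, Prob g =>
      exists H K : pfun, computable H /\ computable K /\
        forall G : pfun, realizes G g -> realizes (wcompose H K G) f
  end.

Definition p_id : problem := Prob (Mvmap baire_space baire_space (fun p q => p = q)).

Definition p_zero : problem :=
  Prob (Mvmap baire_space baire_space (fun _ _ => False)).

Definition p_const (A : baire -> Prop) : problem :=
  if excluded_middle_informative (exists q, A q)
  then Prob (Mvmap baire_space baire_space (fun _ q => A q))
  else Top.

Definition mv_completion (f : mvmap) : mvmap :=
  Mvmap (completion (src f)) (completion (tgt f))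
    (fun a b =>
       (exists x y, a = Some x /\ b = Some y /\ f x y) \/
       ~ (exists x, a = Some x /\ mdom f x)).

Definition mv_parallel (f : mvmap) : mvmap :=
  Mvmap (seq_space (src f)) (seq_space (tgt f))
    (fun x y => forall i, f (x i) (y i)).

Definition mv_sup (f g : mvmap) : mvmap :=
  Mvmap (sum_space (src f) (src g)) (sum_space (tgt f) (tgt g))
    (fun a b => match a, b with
                | inl x, inl y => f x y
                | inr u, inr v => g u v
                | _, _ => False
                end).

Definition mv_inf (f g : mvmap) : mvmap :=
  Mvmap (prod_space (src f) (src g)) (sum_space (tgt f) (tgt g))
    (fun a b => mdom f (fst a) /\ mdom g (snd a) /\
                match b with
                | inl y => f (fst a) y
                | inr v => g (snd a) v
                end).

Definition p_completion (f : problem) : problem :=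
  match f with Prob f => Prob (mv_completion f) | Top => Top end.

Definition p_parallel (f : problem) : problem :=
  match f with Prob f => Prob (mv_parallel f) | Top => Top end.

Definition p_sup (f g : problem) : problem :=
  match f, g with
  | Prob f, Prob g => Prob (mv_sup f g)
  | _, _ => Top
  end.

Definition p_inf (f g : problem) : problem :=
  match f, g with
  | Prob f, Prob g => Prob (mv_inf f g)
  | Prob f, Top => Prob f
  | Top, g => g
  end.

(** [f^r], the composition of [f] with the representation of its source and
    the inverse of the representation of its target. *)
Definition mv_r (f : mvmap) : baire -> baire -> Prop :=
  mcomp (fun (y : tgt f) q => rep q y) (mcomp f (@rep (src f))).

(** [mv_mimp phi g f] is [g ->> f]; the triple [<n, k, q>] is
    [scons n (scons k q)]. *)
Definition mv_mimp (phi : nat -> pfun) (g f : mvmap) : mvmap :=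
  Mvmap baire_space baire_space
    (fun p t => exists n k q, t = scons n (scons k q) /\
       let h := mcomp (fun r s => phi n (spair q r) s) (mcomp (mv_r g) (phi k)) in
       mdom h p /\ forall s, h p s -> mv_r f p s).

(** The multiplicative implication. In the case of two maps the
    value is [Top] exactly if [g] is nowhere defined and [f] is not. *)
Definition p_mimp (phi : nat -> pfun) (g f : problem) : problem :=
  match g, f with
  | Top, _ => p_zero
  | Prob _, Top => Top
  | Prob g, Prob f =>
      if excluded_middle_informative ((exists u, mdom g u) \/ ~ exists x, mdom f x)
      then Prob (mv_mimp phi g f)
      else Top
  end.

(** * Parallelized total Weihrauch reducibility *)

Definition p_pt (f : problem) : problem := p_parallel (p_completion f).

Definition ptw_le (f g : problem) : Prop := w_le f (p_pt g).

Definition ptw_inf (f g : problem) : problem := p_inf (p_pt f) (p_pt g).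

(** [ptw_imp phi g f] is the implication from [g] to [f]. *)
Definition ptw_imp (phi : nat -> pfun) (g f : problem) : problem :=
  p_mimp phi (p_pt g) (p_pt f).

(** * Degrees *)

Definition deg_class {T : Type} (le : T -> T -> Prop) (a : T) : T -> Prop :=
  fun b => le a b /\ le b a.

Definition degree {T : Type} (le : T -> T -> Prop) : Type :=
  {D : T -> Prop | exists a, D = deg_class le a}.

Definition deg {T : Type} (le : T -> T -> Prop) (a : T) : degree le :=
  exist _ (deg_class le a) (ex_intro _ a eq_refl).

Definition mdegree : Type := degree med_le.
Definition wdegree : Type := degree ptw_le.
Definition mdeg : (baire -> Prop) -> mdegree := deg med_le.
Definition wdeg : problem -> wdegree := deg ptw_le.

(* Main.v *)
From Stdlib Require Import Arith List Lia ClassicalEpsilon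
  FunctionalExtensionality PropExtensionality.
From Stdlib Require Cantor.
Require Import Defs.
Import ListNotations.

(* The map reflects the order because the parallelized completion of [c_B] may be
   answered with copies of one fixed [b] in [B], so a reduction of [c_A] to it,
   applied to a fixed instance, is a Medvedev reduction. For each operation the two
   degrees are compared by such uniform translations of answers; the implication
   needs only a universal program.
   Representations play no role in this: as a realizer can take any solution as its
   answer to a given query, reducibility of two problems is a matter of single
   queries and answers, given by names. That reducibility to parallelized completions
   is transitive rests on one fact about programs: step-bounded evaluation turns every
   partial computable family of streams into a total one of completed names, which
   emits values in order and pads with [0] while waiting. *)

Local Notation pack a b := (Cantor.to_nat (a, b)).
Local Notation unpackl n := (fst (Cantor.of_nat n)).
Local Notation unpackr n := (snd (Cantor.of_nat n)).

Local Opaque Cantor.to_nat Cantor.of_nat.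

Create HintDb computability.

(** * Total computable operators *)

Lemma unpackl_pack a b : unpackl (pack a b) = a.
Proof. now rewrite Cantor.cancel_of_to. Qed.

Lemma unpackr_pack a b : unpackr (pack a b) = b.
Proof. now rewrite Cantor.cancel_of_to. Qed.

Lemma pack_unpack n : pack (unpackl n) (unpackr n) = n.
Proof. now rewrite <- surjective_pairing, Cantor.cancel_to_of. Qed.

Lemma pack_surjective n : exists a b, n = pack a b.
Proof. exists (unpackl n), (unpackr n). symmetry. apply pack_unpack. Qed.

Definition computable_op (Phi : baire -> baire) : Prop :=
  exists e, forall p i, eval p e i (Phi p i).

Lemma computable_op_ext Phi Psi :
  (forall p i, Phi p i = Psi p i) -> computable_op Phi -> computable_op Psi.
Proof. intros E [e He]. exists e. intros p i. rewrite <- E. apply He. Qed.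

Lemma computable_op_id : computable_op (fun p => p).
Proof. now exists coracle. Qed.

Lemma computable_op_app Psi N :
  computable_op Psi -> computable_op N -> computable_op (fun p i => Psi p (N p i)).
Proof. intros [f Hf] [e He]. exists (ccomp f e). intros p i. simpl. eauto. Qed.

Lemma computable_op_pack M N :
  computable_op M -> computable_op N ->
  computable_op (fun p i => pack (M p i) (N p i)).
Proof.
  intros [e He] [f Hf]. exists (cpair e f). intros p i. simpl.
  exists (M p i), (N p i). auto.
Qed.

Lemma computable_op_unpackl N :
  computable_op N -> computable_op (fun p i => unpackl (N p i)).
Proof. intros [e He]. exists (ccomp cleft e). intros p i. simpl. eauto. Qed.

Lemma computable_op_unpackr N :
  computable_op N -> computable_op (fun p i => unpackr (N p i)).
Proof. intros [e He]. exists (ccomp cright e). intros p i. simpl. eauto. Qed.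

Lemma computable_op_index : computable_op (fun _ i => i).
Proof.
  exists (cpair cleft cright). intros p i. simpl.
  exists (unpackl i), (unpackr i). now rewrite pack_unpack.
Qed.

Lemma computable_op_succ : computable_op (fun _ => S).
Proof. now exists csucc. Qed.

Lemma computable_op_const c : computable_op (fun _ _ => c).
Proof.
  induction c as [|c IH].
  - now exists czero.
  - exact (computable_op_app _ _ computable_op_succ IH).
Qed.

Lemma computable_op_oracle N :
  computable_op N -> computable_op (fun p i => p (N p i)).
Proof. exact (computable_op_app _ N computable_op_id). Qed.

Lemma computable_op_app2 (F : baire -> nat -> nat -> nat) M N :
  computable_op (fun p m => F p (unpackl m) (unpackr m)) ->
  computable_op M -> computable_op N ->
  computable_op (fun p i => F p (M p i) (N p i)).
Proof.
  intros HF HM HN.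
  pose proof (computable_op_app _ _ HF (computable_op_pack _ _ HM HN)) as HFMN.
  revert HFMN. apply computable_op_ext. intros p i.
  now rewrite unpackl_pack, unpackr_pack.
Qed.

Lemma computable_op_nat_rec (z N : baire -> baire)
  (s : baire -> nat -> nat -> nat -> nat) :
  computable_op z ->
  computable_op (fun p m =>
    s p (unpackl m) (unpackl (unpackr m)) (unpackr (unpackr m))) ->
  computable_op N ->
  computable_op (fun p i => nat_rect (fun _ => nat) (z p i) (s p i) (N p i)).
Proof.
  intros [f Hf] [g Hg] [n Hn]. destruct computable_op_index as [c Hc].
  exists (ccomp (cprec f g) (cpair c n)). intros p i.
  exists (pack i (N p i)). split.
  - exists i, (N p i). auto.
  - simpl. rewrite unpackl_pack, unpackr_pack. induction (N p i) as [|b IH]; simpl.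
    + apply Hf.
    + eexists. split; [exact IH|].
      specialize (Hg p (pack i (pack b (nat_rect (fun _ => nat) (z p i) (s p i) b)))).
      now rewrite !unpackr_pack, !unpackl_pack in Hg.
Qed.

#[local] Hint Resolve computable_op_pack computable_op_unpackl computable_op_unpackr
  computable_op_index computable_op_succ computable_op_const computable_op_oracle
  : computability.

#[local] Hint Extern 3 (computable_op (fun p i => ?f (@?N p i))) =>
  apply (computable_op_app (fun _ => f) N); cbv beta : computability.
#[local] Hint Extern 3 (computable_op (fun p i => ?f (@?Phi p) (@?N p i))) =>
  apply (computable_op_app (fun p => f (Phi p)) N); cbv beta : computability.
#[local] Hint Extern 4 (computable_op (fun p i => ?f (@?M p i) (@?N p i))) =>
  apply (computable_op_app2 (fun _ => f) M N); cbv beta : computability.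
#[local] Hint Extern 1 (computable_op (fun p i => nat_rect _ _ _ _)) =>
  refine (computable_op_nat_rec _ _ _ _ _ _); cbv beta : computability.

Local Ltac computability := solve [auto 100 with computability nocore].

Lemma computable_op_case (N z : baire -> baire) (s : baire -> nat -> nat -> nat) :
  computable_op N -> computable_op z ->
  computable_op (fun p m => s p (unpackl m) (unpackr m)) ->
  computable_op (fun p i => match N p i with 0 => z p i | S m => s p i m end).
Proof.
  intros HN Hz Hs.
  apply computable_op_ext with
    (fun p i => nat_rect (fun _ => nat) (z p i) (fun b _ => s p i b) (N p i)).
  - intros p i. now destruct (N p i).
  - apply computable_op_nat_rec with (s := fun p i b _ => s p i b); auto.
    apply (computable_op_app2 s); computability.
Qed.

#[local] Hint Extern 1
  (computable_op (fun p i => match _ with 0 => _ | S _ => _ end)) =>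
  refine (computable_op_case _ _ _ _ _ _); cbv beta : computability.

Lemma computable_op_pred : computable_op (fun _ => pred).
Proof. unfold pred. computability. Qed.

Lemma computable_op_add : computable_op (fun _ m => unpackl m + unpackr m).
Proof.
  apply computable_op_ext with (fun _ m =>
    nat_rect (fun _ => nat) (unpackr m) (fun _ w => S w) (unpackl m)).
  - intros p m. induction (unpackl m); simpl; congruence.
  - computability.
Qed.

#[local] Hint Resolve computable_op_pred computable_op_add : computability.

Lemma computable_op_sub : computable_op (fun _ m => unpackl m - unpackr m).
Proof.
  apply computable_op_ext with (fun _ m =>
    nat_rect (fun _ => nat) (unpackl m) (fun _ w => pred w) (unpackr m)).
  - intros p m. induction (unpackr m); simpl; lia.
  - computability.
Qed.

#[local] Hint Resolve computable_op_sub : computability.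

Lemma computable_op_parity N :
  computable_op N -> computable_op (fun p i => Nat.b2n (Nat.odd (N p i))).
Proof.
  intros HN. apply computable_op_ext with (fun p i =>
    nat_rect (fun _ => nat) 0 (fun _ w => 1 - w) (N p i)).
  - intros p i. induction (N p i) as [|n IH]; [reflexivity|].
    cbn [nat_rect]. rewrite IH, Nat.odd_succ, <- Nat.negb_odd.
    now destruct (Nat.odd n).
  - computability.
Qed.

#[local] Hint Resolve computable_op_parity : computability.

Lemma computable_op_div2 : computable_op (fun _ => Nat.div2).
Proof.
  apply computable_op_ext with (fun _ n =>
    nat_rect (fun _ => nat) 0 (fun b w => w + Nat.b2n (Nat.odd b)) n).
  - intros _ n. induction n as [|n IH]; [reflexivity|].
    cbn [nat_rect]. rewrite IH.
    pose proof (Nat.div2_odd n) as En. pose proof (Nat.div2_odd (S n)) as ES.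
    rewrite Nat.odd_succ, <- Nat.negb_odd in ES.
    destruct (Nat.odd n); cbn [Nat.b2n negb] in *; lia.
  - computability.
Qed.

#[local] Hint Resolve computable_op_div2 : computability.

Lemma computable_op_spair Phi Psi :
  computable_op Phi -> computable_op Psi ->
  computable_op (fun p => spair (Phi p) (Psi p)).
Proof.
  intros HPhi HPsi.
  apply computable_op_ext with (fun p i => match Nat.b2n (Nat.odd i) with
    | 0 => Phi p (Nat.div2 i) | S _ => Psi p (Nat.div2 i) end).
  - intros p i. unfold spair. rewrite <- Nat.negb_odd. now destruct (Nat.odd i).
  - computability.
Qed.

Lemma computable_op_sfst Phi :
  computable_op Phi -> computable_op (fun p => sfst (Phi p)).
Proof.
  intros H. apply computable_op_ext with (fun p i => Phi p (i + i)).
  - intros p i. unfold sfst. f_equal. lia.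
  - computability.
Qed.

Lemma computable_op_ssnd Phi :
  computable_op Phi -> computable_op (fun p => ssnd (Phi p)).
Proof.
  intros H. apply computable_op_ext with (fun p i => Phi p (S (i + i))).
  - intros p i. unfold ssnd. f_equal. lia.
  - computability.
Qed.

Lemma computable_op_stail Phi :
  computable_op Phi -> computable_op (fun p => stail (Phi p)).
Proof. intros H. unfold stail. computability. Qed.

Lemma computable_op_scons (N : baire -> nat) Phi :
  computable_op (fun p _ => N p) -> computable_op Phi ->
  computable_op (fun p => scons (N p) (Phi p)).
Proof. intros HN H. unfold scons. computability. Qed.

Lemma computable_op_sproj (N : baire -> nat) Phi :
  computable_op (fun p _ => N p) -> computable_op Phi ->
  computable_op (fun p => sproj (N p) (Phi p)).
Proof. intros HN H. unfold sproj. computability. Qed.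

Definition stuple (s : nat -> baire) : baire := fun n => s (unpackl n) (unpackr n).

Lemma sproj_stuple i s : sproj i (stuple s) = s i.
Proof.
  extensionality j. unfold sproj, stuple. now rewrite unpackl_pack, unpackr_pack.
Qed.

Lemma computable_op_stuple (F : baire -> nat -> baire) :
  computable_op (fun p n => F p (unpackl n) (unpackr n)) ->
  computable_op (fun p => stuple (F p)).
Proof. trivial. Qed.

#[local] Hint Resolve computable_op_spair computable_op_sfst computable_op_ssnd
  computable_op_stail computable_op_scons computable_op_sproj : computability.

(** * Substituting a program for the oracle *)

Fixpoint csubst (k e : code) : code :=
  match e with
  | coracle => k
  | cpair f g => cpair (csubst k f) (csubst k g)
  | ccomp f g => ccomp (csubst k f) (csubst k g)
  | cprec f g => cprec (csubst k f) (csubst k g)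
  | cmu f => cmu (csubst k f)
  | _ => e
  end.

Lemma prec_graph_ext (f f' g g' : nat -> nat -> Prop) :
  (forall n v, f n v <-> f' n v) -> (forall n v, g n v <-> g' n v) ->
  forall a b v, prec_graph f g a b v <-> prec_graph f' g' a b v.
Proof.
  intros Ef Eg a b. induction b as [|b IH]; intros v; simpl; [apply Ef|].
  now setoid_rewrite IH; setoid_rewrite Eg.
Qed.

Lemma eval_csubst p k q : computed k p q ->
  forall e n v, eval p (csubst k e) n v <-> eval q e n v.
Proof.
  intros Hk e.
  induction e as [| | | | |f IHf g IHg|f IHf g IHg|f IHf g IHg|f IHf];
    intros n v; simpl; try reflexivity.
  - split; [|intros ->; apply Hk].
    intros H. exact (eval_functional _ _ _ _ _ H (Hk n)).
  - now setoid_rewrite IHf; setoid_rewrite IHg.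
  - now setoid_rewrite IHf; setoid_rewrite IHg.
  - now apply prec_graph_ext.
  - now setoid_rewrite IHf.
Qed.

(** * Step-bounded evaluation *)

(* The state of the search below [t] for the least [j] with [r j] finished with
   result [0], that is, with [r j = 1]: [0] while the search goes on, [1] once it is
   blocked by an unfinished computation and [S (S m)] once [m] has been found. *)
Definition mu_state (r : nat -> nat) (t : nat) : nat :=
  nat_rect (fun _ => nat) 0
    (fun j s => match s with
                | 0 => match r j with
                       | 0 => 1
                       | S v => match v with 0 => S (S j) | S _ => 0 end
                       end
                | S s' => S s'
                end) t.

(* The value [0] means that no result has been found yet, and [S m] that the
   result is [m]. *)
Fixpoint run (p : baire) (e : code) (t n : nat) : nat :=
  match e with
  | czero => 1
  | csucc => S (S n)
  | cleft => S (unpackl n)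
  | cright => S (unpackr n)
  | coracle => S (p n)
  | cpair f g =>
      match run p f t n with
      | 0 => 0
      | S a => match run p g t n with 0 => 0 | S b => S (pack a b) end
      end
  | ccomp f g => match run p g t n with 0 => 0 | S a => run p f t a end
  | cprec f g =>
      nat_rect (fun _ => nat) (run p f t (unpackl n))
        (fun b w => match w with
                    | 0 => 0
                    | S w' => run p g t (pack (unpackl n) (pack b w'))
                    end) (unpackr n)
  | cmu f => pred (mu_state (fun j => run p f t (pack n j)) t)
  end.

Lemma computable_op_run (oracle : baire -> nat -> baire) e :
  computable_op (fun p m => oracle p (unpackl m) (unpackr m)) ->
  forall M T N, computable_op M -> computable_op T -> computable_op N ->
  computable_op (fun p i => run (oracle p (M p i)) e (T p i) (N p i)).
Proof.
  intros Horacle.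
  assert (oracle_app : forall M N, computable_op M -> computable_op N ->
    computable_op (fun p i => oracle p (M p i) (N p i))) by
    (intros M N; now apply computable_op_app2).
  induction e; intros M T N HM HT HN; cbn [run]; unfold mu_state; computability.
Qed.

Lemma mu_state_searching r t :
  mu_state r t = 0 <-> forall j, j < t -> 2 <= r j.
Proof.
  induction t as [|t IH]; [split; [lia|reflexivity]|].
  unfold mu_state in *. cbn [nat_rect]. split.
  - intros H j Hj. destruct (nat_rect _ _ _ t); [|discriminate].
    destruct (Nat.eq_dec j t) as [->|]; [|apply IH; lia].
    destruct (r t) as [|[|v]]; lia.
  - intros H. rewrite (proj2 IH) by (intros; apply H; lia).
    specialize (H t). destruct (r t) as [|[|v]]; lia.
Qed.

Lemma mu_state_found r t m :
  mu_state r t = S (S m) <->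
  m < t /\ r m = 1 /\ forall j, j < m -> 2 <= r j.
Proof.
  induction t as [|t IH]; [split; [discriminate|lia]|].
  pose proof (mu_state_searching r t) as Searching.
  unfold mu_state in *. cbn [nat_rect]. destruct (nat_rect _ _ _ t) as [|s].
  - assert (Before : forall j, j < t -> 2 <= r j) by now apply Searching.
    assert (At : m < t -> 2 <= r m) by apply Before.
    split.
    + destruct (r t) as [|[|v]] eqn:Et; intros [= <-]. auto.
    + intros (Hm & Hr & _). assert (m = t) as -> by lia. now rewrite Hr.
  - rewrite IH. split; intros (Hm & Hr & H); repeat split; auto.
    destruct (Nat.eq_dec m t) as [->|]; [|lia].
    apply Searching in H. discriminate.
Qed.

Lemma run_pair p f g t n m :
  run p (cpair f g) t n = S m <->
  exists a b, run p f t n = S a /\ run p g t n = S b /\ m = pack a b.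
Proof.
  simpl. destruct (run p f t n) as [|a], (run p g t n) as [|b];
    (split; [intros [= <-]; eauto|]);
    intros (a' & b' & [= <-] & [= <-] & ->); reflexivity.
Qed.

Lemma run_comp p f g t n m :
  run p (ccomp f g) t n = S m <->
  exists a, run p g t n = S a /\ run p f t a = S m.
Proof.
  simpl. destruct (run p g t n) as [|a].
  - split; [discriminate|]. intros (a & H & _). discriminate.
  - split; [eauto|]. intros (a' & [= <-] & H). exact H.
Qed.

Lemma run_prec_0 p f g t a : run p (cprec f g) t (pack a 0) = run p f t a.
Proof. cbn [run]. now rewrite unpackl_pack, unpackr_pack. Qed.

Lemma run_prec_S p f g t a b v :
  run p (cprec f g) t (pack a (S b)) = S v <->
  exists w, run p (cprec f g) t (pack a b) = S w /\
            run p g t (pack a (pack b w)) = S v.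
Proof.
  cbn [run]. rewrite !unpackl_pack, !unpackr_pack. cbn [nat_rect].
  destruct (nat_rect _ _ _ b) as [|w].
  - split; [discriminate|]. intros (w & H & _). discriminate.
  - split; [eauto|]. intros (w' & [= <-] & H). exact H.
Qed.

Lemma run_mu p f t n m :
  run p (cmu f) t n = S m <->
  m < t /\ run p f t (pack n m) = 1 /\
  forall j, j < m -> exists v, run p f t (pack n j) = S (S v).
Proof.
  transitivity (m < t /\ run p f t (pack n m) = 1 /\
    forall j, j < m -> 2 <= run p f t (pack n j)).
  - rewrite <- (mu_state_found (fun j => run p f t (pack n j))). cbn [run]. lia.
  - split; intros (Hm & H0 & HS); repeat split; auto; intros j Hj.
    + exists (run p f t (pack n j) - 2). specialize (HS j Hj). lia.
    + destruct (HS j Hj) as [v ->]. lia.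
Qed.

Lemma eval_prec p f g a b m :
  eval p (cprec f g) (pack a b) m <-> prec_graph (eval p f) (eval p g) a b m.
Proof. cbn [eval]. now rewrite unpackl_pack, unpackr_pack. Qed.

Lemma run_mono p e : forall t u n m,
  t <= u -> run p e t n = S m -> run p e u n = S m.
Proof.
  induction e as [| | | | |f IHf g IHg|f IHf g IHg|f IHf g IHg|f IHf];
    intros t u n m Htu; try (simpl; auto; fail).
  - rewrite !run_pair. intros (a & b & Ha & Hb & ->). eauto 8.
  - rewrite !run_comp. intros (a & Ha & Hm). eauto.
  - destruct (pack_surjective n) as (a & b & ->). revert m.
    induction b as [|b IHb]; intros m.
    + rewrite !run_prec_0. eauto.
    + rewrite !run_prec_S. intros (w & Hw & Hm). eauto.
  - rewrite !run_mu. intros (Hm & H0 & HS). repeat split; [lia|eauto|].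
    intros j Hj. destruct (HS j Hj) as [v Hv]. eauto.
Qed.

Lemma run_sound p e : forall t n m, run p e t n = S m -> eval p e n m.
Proof.
  induction e as [| | | | |f IHf g IHg|f IHf g IHg|f IHf g IHg|f IHf];
    intros t n m; try (simpl; congruence).
  - rewrite run_pair. intros (a & b & Ha & Hb & ->). exists a, b. eauto.
  - rewrite run_comp. intros (a & Ha & Hm). exists a. eauto.
  - destruct (pack_surjective n) as (a & b & ->). rewrite eval_prec. revert m.
    induction b as [|b IHb]; intros m.
    + rewrite run_prec_0. apply IHf.
    + rewrite run_prec_S. intros (w & Hw & Hm). exists w. eauto.
  - rewrite run_mu. intros (Hm & H0 & HS). split; [eauto|].
    intros j Hj. destruct (HS j Hj) as [v Hv]. eauto.
Qed.

Lemma run_common_bound p e f t u n m a b :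
  run p e t n = S a -> run p f u m = S b ->
  exists v, run p e v n = S a /\ run p f v m = S b.
Proof.
  intros He Hf. exists (max t u). split.
  - exact (run_mono p e _ _ _ _ (Nat.le_max_l t u) He).
  - exact (run_mono p f _ _ _ _ (Nat.le_max_r t u) Hf).
Qed.

Lemma uniform_bound (P : nat -> nat -> Prop) m :
  (forall j t u, t <= u -> P j t -> P j u) ->
  (forall j, j < m -> exists t, P j t) -> exists t, forall j, j < m -> P j t.
Proof.
  intros Mono. induction m as [|m IH]; intros H; [exists 0; lia|].
  destruct IH as [t Ht]; [auto|]. destruct (H m) as [u Hu]; [lia|].
  exists (max t u). intros j Hj. destruct (Nat.eq_dec j m) as [->|].
  - apply (Mono _ u); [lia|assumption].
  - apply (Mono _ t); [lia|]. apply Ht. lia.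
Qed.

Lemma run_complete p e : forall n m, eval p e n m -> exists t, run p e t n = S m.
Proof.
  induction e as [| | | | |f IHf g IHg|f IHf g IHg|f IHf g IHg|f IHf];
    intros n m; try (simpl; intros ->; now exists 0).
  - intros (a & b & Ha & Hb & ->).
    destruct (IHf _ _ Ha) as [t Ht], (IHg _ _ Hb) as [u Hu].
    destruct (run_common_bound _ _ _ _ _ _ _ _ _ Ht Hu) as (v & Hf & Hg).
    exists v. apply run_pair. eauto.
  - intros (a & Ha & Hm).
    destruct (IHg _ _ Ha) as [t Ht], (IHf _ _ Hm) as [u Hu].
    destruct (run_common_bound _ _ _ _ _ _ _ _ _ Ht Hu) as (v & Hg & Hf).
    exists v. apply run_comp. eauto.
  - destruct (pack_surjective n) as (a & b & ->). rewrite eval_prec. revert m.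
    induction b as [|b IHb]; intros m.
    + setoid_rewrite run_prec_0. apply IHf.
    + intros (w & Hw & Hm).
      destruct (IHb _ Hw) as [t Ht], (IHg _ _ Hm) as [u Hu].
      destruct (run_common_bound _ _ _ _ _ _ _ _ _ Ht Hu) as (v & Hprec & Hg).
      exists v. apply run_prec_S. eauto.
  - intros [H0 HS]. destruct (IHf _ _ H0) as [t Ht].
    destruct (uniform_bound (fun j t => exists v, run p f t (pack n j) = S (S v)) m)
      as [u Hu].
    + intros j t1 t2 Hle [v Hv]. exists v. exact (run_mono _ _ _ _ _ _ Hle Hv).
    + intros j Hj. destruct (HS j Hj) as [v Hv]. destruct (IHf _ _ Hv). eauto.
    + exists (S m + t + u). apply run_mu. repeat split; [lia| |].
      * apply (run_mono p f t); [lia|assumption].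
      * intros j Hj. destruct (Hu j Hj) as [v Hv]. exists v.
        apply (run_mono p f u); [lia|assumption].
Qed.

(** * Completed names *)

Fixpoint written (p : baire) (k : nat) : nat :=
  match k with
  | 0 => 0
  | S k => match p k with 0 => written p k | S _ => S (written p k) end
  end.

Lemma dec_word_S p k :
  dec_word p (S k) =
  dec_word p k ++ match p k with 0 => [] | S m => [m] end.
Proof.
  unfold dec_word. rewrite seq_S, flat_map_app. simpl. now rewrite app_nil_r.
Qed.

Lemma length_dec_word p k : length (dec_word p k) = written p k.
Proof.
  induction k as [|k IH]; [reflexivity|].
  rewrite dec_word_S, length_app, IH. simpl. destruct (p k); simpl; lia.
Qed.

Lemma written_mono p k l : k <= l -> written p k <= written p l.
Proof.
  induction 1 as [|l _ IH]; [reflexivity|]. simpl. destruct (p l); lia.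
Qed.

Lemma written_attained p k m :
  m < written p k -> exists j v, written p j = m /\ p j = S v.
Proof.
  induction k as [|k IH]; simpl; [lia|]. intros H.
  destruct (le_lt_dec (written p k) m) as [L|L].
  - destruct (p k) as [|v] eqn:E; [lia|]. exists k, v. lia.
  - exact (IH L).
Qed.

Lemma written_inj p j k v w :
  p j = S v -> p k = S w -> written p j = written p k -> j = k.
Proof.
  intros Hj Hk E.
  destruct (lt_eq_lt_dec j k) as [[L| ->]|L]; [|reflexivity|].
  - apply (written_mono p (S j) k) in L. simpl in L. rewrite Hj in L. lia.
  - apply (written_mono p (S k) j) in L. simpl in L. rewrite Hk in L. lia.
Qed.

Lemma dec_iff p q :
  dec p q <-> forall m, exists k, written p k = m /\ p k = S (q m).
Proof.
  unfold dec. setoid_rewrite length_dec_word. split.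
  - intros [Word Unbounded] m. destruct (Unbounded m) as [l Hl].
    destruct (written_attained p l m Hl) as (k & v & <- & Hv).
    exists k. split; [reflexivity|].
    specialize (Word (S k)) as WordS. simpl in WordS.
    rewrite dec_word_S, Hv, seq_S, map_app in WordS.
    apply app_inj_tail in WordS as [_ ->]. exact Hv.
  - intros H. split.
    + induction k as [|k IH]; [reflexivity|]. simpl written.
      rewrite dec_word_S. destruct (p k) as [|v] eqn:E.
      * now rewrite app_nil_r.
      * destruct (H (written p k)) as (k' & Hw & Hk').
        rewrite (written_inj p k' k _ _ Hk' E Hw), E in Hk'.
        injection Hk' as ->. now rewrite seq_S, map_app, <- IH.
    + intros m. destruct (H m) as (k & <- & Hk). exists (S k).
      simpl. rewrite Hk. lia.
Qed.

Lemma computable_op_written : computable_op written.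
Proof.
  apply computable_op_ext with (fun p k => nat_rect (fun _ => nat) 0
    (fun j w => match p j with 0 => w | S _ => S w end) k).
  - intros p k. induction k as [|k IH]; [reflexivity|]. simpl. now rewrite IH.
  - computability.
Qed.

Definition emitted (e : code) (o : baire) (t : nat) : nat :=
  nat_rect (fun _ => nat) 0
    (fun u m => match run o e u m with 0 => m | S _ => S m end) t.

Definition totalized (e : code) (o : baire) : baire :=
  fun t => run o e t (emitted e o t).

Lemma written_totalized e o t : written (totalized e o) t = emitted e o t.
Proof.
  induction t as [|t IH]; [reflexivity|]. simpl.
  change (emitted e o (S t)) with (match totalized e o t with
    | 0 => emitted e o t | S _ => S (emitted e o t) end).
  now rewrite IH.
Qed.

Lemma written_totalized_unbounded e o q m :
  computed e o q -> exists t, m <= written (totalized e o) t.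
Proof.
  intros H. induction m as [|m [t Ht]]; [exists 0; lia|].
  destruct (run_complete o e _ _ (H m)) as [u Hu].
  pose proof (written_mono (totalized e o) _ _ (Nat.le_max_l t u)) as Hmono.
  destruct (Nat.eq_dec (written (totalized e o) (max t u)) m) as [E|];
    [|exists (max t u); lia].
  assert (Hit : totalized e o (max t u) = S (q m)).
  { unfold totalized. rewrite <- written_totalized, E.
    exact (run_mono o e _ _ _ _ (Nat.le_max_r t u) Hu). }
  exists (S (max t u)). simpl. rewrite Hit. lia.
Qed.

Lemma dec_totalized e o q : computed e o q -> dec (totalized e o) q.
Proof.
  intros H. apply dec_iff. intros m.
  destruct (written_totalized_unbounded e o q (S m) H) as [t Ht].
  destruct (written_attained _ _ _ Ht) as (k & v & Hw & Hv).
  exists k. split; [assumption|]. rewrite Hv. f_equal.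
  unfold totalized in Hv. rewrite <- written_totalized, Hw in Hv.
  exact (eval_functional _ _ _ _ _ (run_sound _ _ _ _ _ Hv) (H m)).
Qed.

Lemma computable_op_totalized e :
  computable_op (fun p n => totalized e (scons (unpackl n) p) (unpackr n)).
Proof.
  assert (Run : forall M T N,
    computable_op M -> computable_op T -> computable_op N ->
    computable_op (fun p n => run (scons (M p n) p) e (T p n) (N p n))).
  { apply (computable_op_run (fun p i => scons i p)). unfold scons. computability. }
  unfold totalized, emitted. computability.
Qed.

(** * Computable relations *)

Definition computable_rel (R : baire -> baire -> Prop) : Prop :=
  exists e, forall p q, R p q -> computed e p q.

Lemma computable_rel_op Phi :
  computable_op Phi -> computable_rel (fun p q => q = Phi p).
Proof. intros [e He]. exists e. intros p q ->. exact (He p). Qed.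

Lemma computable_rel_comp (R T : baire -> baire -> Prop) :
  computable_rel R -> computable_rel T ->
  computable_rel (fun p r => exists q, R p q /\ T q r).
Proof.
  intros [e He] [f Hf]. exists (csubst e f). intros p r (q & HR & HT) i.
  apply (eval_csubst _ _ _ (He _ _ HR)), (Hf _ _ HT).
Qed.

Lemma computable_rel_precomp Phi R :
  computable_op Phi -> computable_rel R -> computable_rel (fun p q => R (Phi p) q).
Proof.
  intros HPhi HR.
  destruct (computable_rel_comp _ _ (computable_rel_op _ HPhi) HR) as [e He].
  exists e. intros p q Hq. apply He. eauto.
Qed.

Lemma computable_rel_spair R :
  computable_rel R -> computable_rel (fun p r => exists q, R p q /\ r = spair p q).
Proof.
  intros [e He].
  (* Tabulate the oracle along with the result, then rearrange. *)
  assert (Unzip : computable_op (fun r =>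
    spair (fun i => unpackl (r i)) (fun i => unpackr (r i)))) by computability.
  destruct Unzip as [f Hf]. exists (csubst (cpair coracle e) f).
  intros p r (q & Hq & ->) i.
  apply (eval_csubst _ _ (fun i => pack (p i) (q i))).
  - intros j. exists (p j), (q j). repeat split. exact (He _ _ Hq j).
  - replace (spair p q) with (spair (fun i => unpackl (pack (p i) (q i)))
      (fun i => unpackr (pack (p i) (q i)))); [apply Hf|].
    f_equal; extensionality j; [apply unpackl_pack|apply unpackr_pack].
Qed.

Lemma computable_rel_bind (R : baire -> baire -> Prop)
  (T : baire -> baire -> baire -> Prop) :
  computable_rel R -> computable_rel (fun r q => T (sfst r) (ssnd r) q) ->
  computable_rel (fun p q => exists a, R p a /\ T p a q).
Proof.
  intros HR HT.
  destruct (computable_rel_comp _ _ (computable_rel_spair _ HR) HT) as [e He].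
  exists e. intros p q (a & Ha & Hq). apply He. exists (spair p a).
  rewrite sfst_spair, ssnd_spair. eauto.
Qed.

(* The [m]-th letter is written at the first place [k] with [m < written p (S k)]. *)
Lemma computable_rel_dec : computable_rel dec.
Proof.
  pose proof computable_op_written as Written.
  assert (Missing : computable_op
    (fun p n => S (unpackl n) - written p (S (unpackr n)))) by computability.
  destruct Missing as [f Hf], computable_op_pred as [g Hg].
  exists (ccomp (ccomp g coracle) (cmu f)). intros p q H m.
  destruct (proj1 (dec_iff p q) H m) as (k & Hw & Hk).
  assert (Missing : forall j, eval p f (pack m j) (S m - written p (S j))).
  { intros j. pose proof (Hf p (pack m j)) as Hj.
    now rewrite unpackl_pack, unpackr_pack in Hj. }
  exists k. split; [split|].
  - replace 0 with (S m - written p (S k)); [apply Missing|].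
    simpl written. rewrite Hk, Hw. apply Nat.sub_diag.
  - intros j Hj. exists (m - written p (S j)).
    rewrite <- Nat.sub_succ_l; [apply Missing|].
    rewrite <- Hw. now apply written_mono.
  - exists (S (q m)). split; [now symmetry|apply Hg].
Qed.

#[local] Hint Resolve computable_rel_op computable_rel_dec : computability.
#[local] Hint Extern 2 (computable_rel (fun p q => exists a, _ /\ _)) =>
  refine (computable_rel_bind _ _ _ _); cbv beta : computability.
#[local] Hint Extern 2 (computable_rel (fun p q => ?R (@?Phi p) q)) =>
  apply (computable_rel_precomp Phi R) : computability.

Lemma computable_rel_totalize R :
  computable_rel R -> exists D, computable_op D /\
    forall p i q, R (scons i p) q -> dec (sproj i (D p)) q.
Proof.
  intros [e He]. exists (fun p => stuple (fun i => totalized e (scons i p))).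
  split; [apply computable_op_stuple, computable_op_totalized|].
  intros p i q Hq. rewrite sproj_stuple. apply dec_totalized, He, Hq.
Qed.

(** * Problems on Baire space *)

(* An instance need not have solutions: this makes the top element the constant
   problem without solutions. *)
Record bproblem : Type := BProblem {
  instance : baire -> Prop;
  solution : baire -> baire -> Prop
}.

Lemma bproblem_ext F G :
  (forall p, instance F p <-> instance G p) ->
  (forall p q, solution F p q <-> solution G p q) -> F = G.
Proof.
  destruct F as [D R], G as [D' R']. simpl. intros HD HR. f_equal.
  - extensionality p. now apply propositional_extensionality.
  - extensionality p. extensionality q. now apply propositional_extensionality.
Qed.

Definition bp_le (F G : bproblem) : Prop :=
  exists H K, computable_rel H /\ computable_rel K /\
    forall p, instance F p -> exists k, K p k /\ instance G k /\
      forall s, solution G k s -> exists q, H (spair p s) q /\ solution F p q.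

Lemma bp_le_op (F G : bproblem) H K :
  computable_rel H -> computable_op K ->
  (forall p, instance F p -> instance G (K p) /\
     forall s, solution G (K p) s -> exists q, H (spair p s) q /\ solution F p q) ->
  bp_le F G.
Proof.
  intros CH CK FG. exists H, (fun p k => k = K p).
  split; [assumption|]. split; [now apply computable_rel_op|].
  intros p Hp. exists (K p). split; [reflexivity|]. exact (FG p Hp).
Qed.

Lemma bp_le_refl F : bp_le F F.
Proof.
  apply bp_le_op with (fun r q => q = ssnd r) (fun p => p);
    [computability|computability|].
  intros p Hp. split; [assumption|]. intros s Hs.
  exists s. now rewrite ssnd_spair.
Qed.

Lemma bp_le_trans F G E : bp_le F G -> bp_le G E -> bp_le F E.
Proof.
  intros (H & K & CH & CK & FG) (H' & K' & CH' & CK' & GE).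
  exists (fun r q => exists k, K (sfst r) k /\
            exists b, H' (spair k (ssnd r)) b /\ H (spair (sfst r) b) q),
    (fun p k' => exists k, K p k /\ K' k k').
  split; [computability|]. split; [computability|].
  intros p Hp. destruct (FG p Hp) as (k & Hk & Gk & Back).
  destruct (GE k Gk) as (k' & Hk' & Ek' & Back').
  exists k'. repeat split; eauto. intros s Hs.
  destruct (Back' s Hs) as (b & Hb & Gb), (Back b Gb) as (q & Hq & Fq).
  exists q. rewrite sfst_spair, ssnd_spair. eauto 8.
Qed.

Definition bp_equiv (F G : bproblem) : Prop := bp_le F G /\ bp_le G F.

(* The parallelization of the completion: a component that is not a completed name
   of an instance may be answered arbitrarily. *)
Definition bp_pt (F : bproblem) : bproblem :=
  BProblem (fun _ => True)
    (fun p s => forall i x, dec (sproj i p) x -> instance F x ->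
       exists y, dec (sproj i s) y /\ solution F x y).

Definition bp_ptw_le (F G : bproblem) : Prop := bp_le F (bp_pt G).

Definition bp_ptw_equiv (F G : bproblem) : Prop := bp_ptw_le F G /\ bp_ptw_le G F.

Definition const_name (b : baire) : baire := stuple (fun _ j => S (b j)).

Lemma computable_op_const_name Phi :
  computable_op Phi -> computable_op (fun p => const_name (Phi p)).
Proof. intros H. apply computable_op_stuple. computability. Qed.

Lemma dec_sproj_const_name i b : dec (sproj i (const_name b)) b.
Proof. unfold const_name. rewrite sproj_stuple. apply dec_succ. Qed.

Definition slice (i : nat) (s : baire) : baire :=
  stuple (fun j => sproj (pack i j) s).

Lemma computable_op_slice (N : baire -> nat) Phi :
  computable_op (fun p _ => N p) -> computable_op Phi ->
  computable_op (fun p => slice (N p) (Phi p)).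
Proof. intros HN H. apply computable_op_stuple. unfold sproj. computability. Qed.

Lemma sproj_slice i j s : sproj j (slice i s) = sproj (pack i j) s.
Proof. apply sproj_stuple. Qed.

#[local] Hint Resolve computable_op_const_name computable_op_slice : computability.

Lemma bp_ptw_le_refl F : bp_ptw_le F F.
Proof.
  apply bp_le_op with (fun r q => dec (sproj 0 (ssnd r)) q) const_name;
    [computability|computability|].
  intros p Hp. split; [exact I|]. intros s Hs.
  rewrite ssnd_spair. exact (Hs 0 p (dec_sproj_const_name 0 p) Hp).
Qed.

(* Both halves of the reduction are made total, as an instance of [bp_pt F] may
   have components that are not names of instances of [F]; the [i]-th component
   is served by the components [<i, j>] of the query to [bp_pt G]. *)
Lemma bp_pt_least F G : bp_le F (bp_pt G) -> bp_le (bp_pt F) (bp_pt G).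
Proof.
  intros (H & K & CH & CK & FG).
  destruct (computable_rel_totalize (fun r z =>
    exists x, dec (sproj (unpackl (r 0)) (stail r)) x /\
      exists k, K x k /\ dec (sproj (unpackr (r 0)) k) z)) as (DK & CDK & HDK);
    [computability|].
  destruct (computable_rel_totalize (fun r q =>
    exists x, dec (sproj (r 0) (sfst (stail r))) x /\
      H (spair x (slice (r 0) (ssnd (stail r)))) q)) as (DH & CDH & HDH);
    [computability|].
  apply bp_le_op with (fun r q => q = DH r) DK; [computability|assumption|].
  intros p _. split; [exact I|]. intros s Hs.
  exists (DH (spair p s)). split; [reflexivity|]. intros i x Hx Fx.
  destruct (FG x Fx) as (k & Hk & _ & Back).
  destruct (Back (slice i s)) as (q & Hq & Fq).
  - intros j z Hz Gz. rewrite sproj_slice. apply Hs; [|assumption].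
    apply HDK. simpl. rewrite unpackl_pack, unpackr_pack. eauto.
  - exists q. split; [|assumption]. apply HDH. simpl.
    change (stail (scons i (spair p s))) with (spair p s).
    rewrite sfst_spair, ssnd_spair. eauto.
Qed.

Lemma bp_le_ptw_le F G : bp_le F G -> bp_ptw_le F G.
Proof. intros H. exact (bp_le_trans _ _ _ H (bp_ptw_le_refl G)). Qed.

Lemma bp_ptw_le_trans F G E : bp_ptw_le F G -> bp_ptw_le G E -> bp_ptw_le F E.
Proof. intros H H'. exact (bp_le_trans _ _ _ H (bp_pt_least _ _ H')). Qed.

Lemma bp_equiv_ptw_equiv F G : bp_equiv F G -> bp_ptw_equiv F G.
Proof. intros []. split; now apply bp_le_ptw_le. Qed.

Lemma bp_ptw_equiv_trans F G E :
  bp_ptw_equiv F G -> bp_ptw_equiv G E -> bp_ptw_equiv F E.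
Proof. intros [] []. split; eapply bp_ptw_le_trans; eauto. Qed.

(** * Constant problems on Baire space *)

Definition bp_const (A : baire -> Prop) : bproblem :=
  BProblem (fun _ => True) (fun _ q => A q).

Definition bp_top : bproblem := bp_const (fun _ => False).

Lemma bp_le_top F : bp_le F bp_top.
Proof.
  apply bp_le_op with (fun r q => q = r) (fun p => p);
    [computability|computability|].
  intros p _. split; [exact I|intros s []].
Qed.

Definition zeros : baire := fun _ => 0.
Definition ones : baire := fun _ => 1.

Lemma computable_op_zeros : computable_op (fun _ => zeros).
Proof. exact (computable_op_const 0). Qed.

Lemma computable_op_ones : computable_op (fun _ => ones).
Proof. exact (computable_op_const 1). Qed.

#[local] Hint Resolve computable_op_zeros computable_op_ones : computability.

(* Up to the encoding of answers, such a problem asks for an element of [A] regardless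
   of the instance; [ones] is the completed name of a sequence of copies of [zeros]. *)
Record encodes (F : bproblem) (A : baire -> Prop) : Prop := {
  encodes_total : forall p, instance F p;
  encodes_intro : forall p a, A a -> solution F p (const_name a);
  encodes_elim : forall s, solution F ones s -> exists a, dec (sproj 0 s) a /\ A a
}.

Lemma encodes_bp_pt_const A : encodes (bp_pt (bp_const A)) A.
Proof.
  split; simpl; [trivial| |].
  - intros p a Ha i _ _ _. exists a. auto using dec_sproj_const_name.
  - intros s Hs. exact (Hs 0 zeros (dec_succ zeros) I).
Qed.

Lemma bp_const_le (A : baire -> Prop) (G : bproblem) E k :
  computable_rel E -> computable_op (fun _ => k) -> instance G k ->
  (forall s, solution G k s -> exists a, E s a /\ A a) ->
  bp_le (bp_const A) G.
Proof.
  intros CE Ck Gk GA.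
  apply bp_le_op with (fun r q => E (ssnd r) q) (fun _ => k);
    [computability|assumption|].
  intros p _. split; [assumption|]. intros s Hs.
  rewrite ssnd_spair. exact (GA s Hs).
Qed.

Lemma bp_ptw_le_const (F : bproblem) (B : baire -> Prop) E :
  computable_rel E ->
  (forall p b, instance F p -> B b -> exists q, E (spair p b) q /\ solution F p q) ->
  bp_ptw_le F (bp_const B).
Proof.
  intros CE FB.
  apply bp_le_op with
    (fun r q => exists b, dec (sproj 0 (ssnd r)) b /\ E (spair (sfst r) b) q)
    (fun _ => ones); [computability|computability|].
  intros p Hp. split; [exact I|]. intros s Hs.
  destruct (encodes_elim _ _ (encodes_bp_pt_const B) s Hs) as (b & Hb & Bb).
  destruct (FB p b Hp Bb) as (q & Hq & Fq).
  exists q. rewrite sfst_spair, ssnd_spair. eauto.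
Qed.

(** * Medvedev reducibility *)

Lemma med_le_iff (A B : baire -> Prop) :
  med_le A B <->
  exists E, computable_rel E /\ forall p, B p -> exists q, E p q /\ A q.
Proof.
  split.
  - intros (F & CF & D & FBA). exists F. split; [exact CF|].
    intros p Hp. destruct (D p Hp) as [q Hq]. eauto.
  - intros (E & [e He] & EBA). exists (computed e). split; [now exists e|]. split.
    + intros p Hp. destruct (EBA p Hp) as (q & Hq & _). exists q. auto.
    + intros p q Hp Hq. destruct (EBA p Hp) as (q' & Hq' & Aq').
      now rewrite (graph_functional _ _ _ _ Hq (He _ _ Hq')).
Qed.

Lemma med_le_refl A : med_le A A.
Proof.
  apply med_le_iff. exists (fun p q => q = p). split; [computability|eauto].
Qed.

Lemma med_le_trans A B C : med_le A B -> med_le B C -> med_le A C.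
Proof.
  rewrite !med_le_iff. intros (E & CE & EBA) (E' & CE' & ECB).
  exists (fun p r => exists q, E' p q /\ E q r). split; [computability|].
  intros p Hp. destruct (ECB p Hp) as (q & Hq & Bq), (EBA q Bq) as (r & Hr & Ar).
  eauto.
Qed.

Lemma med_le_bp_ptw_le A B : med_le A B <-> bp_ptw_le (bp_const A) (bp_const B).
Proof.
  rewrite med_le_iff. split.
  - intros (E & CE & EBA). apply bp_ptw_le_const with (fun r q => E (ssnd r) q).
    + computability.
    + intros p b _ Bb. rewrite ssnd_spair. exact (EBA b Bb).
  - intros (H & K & CH & _ & AB).
    exists (fun b q => H (spair zeros (const_name b)) q). split; [computability|].
    intros b Bb. destruct (AB zeros I) as (k & _ & _ & Back). apply Back.
    now apply encodes_intro with (1 := encodes_bp_pt_const B).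
Qed.

(** * Suprema and infima *)

Definition bp_sup (F G : bproblem) : bproblem :=
  BProblem
    (fun p => p 0 = 0 /\ instance F (stail p) \/ p 0 = 1 /\ instance G (stail p))
    (fun p s => p 0 = 0 /\ s 0 = 0 /\ solution F (stail p) (stail s) \/
                p 0 = 1 /\ s 0 = 1 /\ solution G (stail p) (stail s)).

Lemma bp_sup_top_l G : bp_equiv (bp_sup bp_top G) bp_top.
Proof.
  split; [apply bp_le_top|].
  apply bp_const_le with (fun s q => q = s) zeros;
    [computability|computability|now left|].
  intros s [(_ & _ & [])|(H & _)]. discriminate.
Qed.

Lemma bp_sup_top_r F : bp_equiv (bp_sup F bp_top) bp_top.
Proof.
  split; [apply bp_le_top|].
  apply bp_const_le with (fun s q => q = s) ones;
    [computability|computability|now right|].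
  intros s [(H & _)|(_ & _ & [])]. discriminate.
Qed.

Lemma bp_const_oplus A B :
  bp_ptw_equiv (bp_const (med_oplus A B)) (bp_sup (bp_const A) (bp_const B)).
Proof.
  split.
  - (* One query to the parallelization asks for both components. *)
    apply bp_const_le with
      (fun s q => exists a, dec (sproj 0 s) a /\
         exists b, dec (sproj 1 s) b /\ q = spair (stail a) (stail b))
      (stuple (fun i j => S (match i with 0 => 0 | S _ => 1 end))).
    + computability.
    + apply computable_op_stuple. computability.
    + exact I.
    + intros s Hs.
      destruct (Hs 0 zeros) as (a & Da & [(_ & _ & Aa)|(E & _)]);
        [rewrite sproj_stuple; apply (dec_succ zeros)|now left| |discriminate].
      destruct (Hs 1 ones) as (b & Db & [(E & _)|(_ & _ & Bb)]);
        [rewrite sproj_stuple; apply (dec_succ ones)|now right|discriminate|].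
      exists (spair (stail a) (stail b)). split; [eauto|].
      exists (stail a), (stail b). auto.
  - apply bp_ptw_le_const with (fun r q => q = scons (r 0) (fun i => match r 0 with
      | 0 => sfst (ssnd r) i | S _ => ssnd (ssnd r) i end)).
    + computability.
    + intros p r Hp (a & b & Aa & Bb & ->). rewrite !ssnd_spair, sfst_spair.
      change (spair p (spair a b) 0) with (p 0).
      eexists. split; [reflexivity|].
      destruct Hp as [[Ep _]|[Ep _]]; rewrite Ep; [left|right];
        repeat split; assumption.
Qed.

Definition bp_inf (F G : bproblem) : bproblem :=
  BProblem
    (fun p => instance F (sfst p) /\ instance G (ssnd p))
    (fun p s => instance F (sfst p) /\ instance G (ssnd p) /\
                (s 0 = 0 /\ solution F (sfst p) (stail s) \/
                 s 0 = 1 /\ solution G (ssnd p) (stail s))).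

Lemma bp_inf_top_l G : bp_equiv (bp_inf bp_top G) G.
Proof.
  split.
  - apply bp_le_op with (fun r q => q = scons 1 (ssnd r)) ssnd;
      [computability|computability|].
    intros p [_ Hp]. split; [assumption|]. intros s Hs.
    exists (scons 1 s). rewrite ssnd_spair. simpl. auto 6.
  - apply bp_le_op with (fun r q => q = stail (ssnd r)) (fun p => spair p p);
      [computability|computability|].
    intros p Hp. simpl. rewrite ssnd_spair. split; [auto|].
    intros s (_ & _ & [[_ []]|[_ Hs]]). exists (stail s). now rewrite ssnd_spair.
Qed.

Lemma bp_inf_top_r F : bp_equiv (bp_inf F bp_top) F.
Proof.
  split.
  - apply bp_le_op with (fun r q => q = scons 0 (ssnd r)) sfst;
      [computability|computability|].
    intros p [Hp _]. split; [assumption|]. intros s Hs.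
    exists (scons 0 s). rewrite ssnd_spair. simpl. auto 6.
  - apply bp_le_op with (fun r q => q = stail (ssnd r)) (fun p => spair p p);
      [computability|computability|].
    intros p Hp. simpl. rewrite sfst_spair. split; [auto|].
    intros s (_ & _ & [[_ Hs]|[_ []]]). exists (stail s). now rewrite ssnd_spair.
Qed.

Lemma bp_const_otimes F G A B :
  encodes F A -> encodes G B ->
  bp_ptw_equiv (bp_const (med_otimes A B)) (bp_inf F G).
Proof.
  intros FA GB. split.
  - apply bp_le_ptw_le, bp_const_le with (fun s q =>
      exists a, dec (sproj 0 (stail s)) a /\ q = scons (s 0) a) ones.
    + computability.
    + computability.
    + split; [apply FA|apply GB].
    + intros s (_ & _ & [[-> Hs]|[-> Hs]]).
      * destruct (encodes_elim _ _ FA _ Hs) as (a & Da & Aa).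
        exists (scons 0 a). split; [eauto|left; eauto].
      * destruct (encodes_elim _ _ GB _ Hs) as (b & Db & Bb).
        exists (scons 1 b). split; [eauto|right; eauto].
  - apply bp_ptw_le_const with
      (fun r q => q = scons (ssnd r 0) (const_name (stail (ssnd r)))).
    + computability.
    + intros p b [Fp Gp] Hb. rewrite ssnd_spair. eexists. split; [reflexivity|].
      repeat split; [assumption..|].
      destruct Hb as [(a & Aa & ->)|(a & Ba & ->)]; [left|right];
        (split; [reflexivity|]).
      * now apply (encodes_intro _ _ FA).
      * now apply (encodes_intro _ _ GB).
Qed.

(** * Weihrauch reducibility on names *)

Lemma mv_r_iff (f : mvmap) p q :
  mv_r f p q <-> exists x y, rep p x /\ f x y /\ rep q y.
Proof.
  unfold mv_r, mcomp. split.
  - intros (_ & y & (_ & x & Hx & Hf) & Hq). eauto.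
  - intros (x & y & Hx & Hf & Hq). split.
    + intros y' _. apply (rep_surjective (tgt f)).
    + exists y. split; [|assumption]. split; [|eauto].
      intros x' Hx'. rewrite (rep_functional _ _ _ _ Hx' Hx). now exists y.
Qed.

Lemma mdom_mv_r (f : mvmap) p : mdom (mv_r f) p <-> exists x, rep p x /\ mdom f x.
Proof.
  unfold mdom. setoid_rewrite mv_r_iff. split.
  - intros (q & x & y & Hx & Hf & _). eauto.
  - intros (x & Hx & y & Hf). destruct (rep_surjective (tgt f) y) as [q Hq]. eauto 6.
Qed.

Lemma realizes_iff F (f : mvmap) :
  realizes F f <-> forall p, mdom (mv_r f) p -> exists q, F p q /\ mv_r f p q.
Proof.
  setoid_rewrite mdom_mv_r. setoid_rewrite mv_r_iff. split.
  - intros HF p (x & Hx & Dx). destruct (HF p x Hx Dx) as (q & y & Hq & Hy & Hf).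
    eauto 8.
  - intros HF p x Hx Dx.
    destruct (HF p) as (q & Hq & x' & y & Hx' & Hf & Hy); [eauto|].
    rewrite (rep_functional _ _ _ _ Hx' Hx) in Hf. eauto.
Qed.

Definition selector_pfun (D : baire -> Prop) (c : baire -> baire) : pfun.
Proof.
  refine (Pfun (fun p q => D p /\ q = c p) _). now intros p q q' [_ ->] [_ ->].
Defined.

Lemma realizes_selector (f : mvmap) c :
  (forall p, mdom (mv_r f) p -> mv_r f p (c p)) ->
  realizes (selector_pfun (mdom (mv_r f)) c) f.
Proof. intros Hc. apply realizes_iff. intros p Dp. exists (c p). simpl. auto. Qed.

Lemma mv_r_selector (f : mvmap) :
  exists c, forall p, mdom (mv_r f) p -> mv_r f p (c p).
Proof.
  apply (choice (fun p q => mdom (mv_r f) p -> mv_r f p q)). intros p.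
  destruct (classic (mdom (mv_r f) p)) as [[q Hq]|N]; [now exists q|].
  now exists p.
Qed.

Definition problem_on_names (f : problem) : bproblem :=
  match f with
  | Prob f => BProblem (mdom (mv_r f)) (mv_r f)
  | Top => bp_top
  end.

Lemma w_le_bp_le (f g : mvmap) :
  w_le (Prob f) (Prob g) ->
  bp_le (problem_on_names (Prob f)) (problem_on_names (Prob g)).
Proof.
  intros (H & K & CH & CK & FG). exists H, K.
  split; [exact CH|]. split; [exact CK|].
  destruct (mv_r_selector g) as [c Hc]. intros p Dp. simpl in *.
  pose proof (proj1 (realizes_iff _ _) (FG _ (realizes_selector g c Hc)) p Dp)
    as (q & (k & s & Hk & [Dk _] & _) & _).
  exists k. split; [assumption|]. split; [assumption|]. intros s' Hs'.
  (* Every solution [s'] of the query [k] is the answer of some realizer. *)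
  pose (c' := fun k' => if excluded_middle_informative (k' = k) then s' else c k').
  assert (Hc' : forall k', mdom (mv_r g) k' -> mv_r g k' (c' k')).
  { intros k' Dk'. unfold c'.
    destruct (excluded_middle_informative (k' = k)) as [->|]; auto. }
  pose proof (proj1 (realizes_iff _ _) (FG _ (realizes_selector g c' Hc')) p Dp)
    as (q' & (k' & t & Hk' & [_ Ht] & Hq') & Fq').
  rewrite (graph_functional _ _ _ _ Hk' Hk) in Ht. unfold c' in Ht.
  destruct (excluded_middle_informative (k = k)) as [_|N]; [|easy].
  subst t. eauto.
Qed.

Lemma bp_le_w_le (f g : mvmap) :
  bp_le (problem_on_names (Prob f)) (problem_on_names (Prob g)) ->
  w_le (Prob f) (Prob g).
Proof.
  intros (H & K & [h Hh] & [k Hk] & FG). exists (computed h), (computed k).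
  split; [now exists h|]. split; [now exists k|]. intros G HG. apply realizes_iff.
  intros p Dp. destruct (FG p Dp) as (a & Ha & Da & Back).
  destruct (proj1 (realizes_iff _ _) HG a Da) as (s & Hs & Gs).
  destruct (Back s Gs) as (q & Hq & Fq).
  exists q. split; [|assumption]. exists a, s. auto.
Qed.

Lemma w_le_iff f g : w_le f g <-> bp_le (problem_on_names f) (problem_on_names g).
Proof.
  destruct g as [g|].
  - destruct f as [f|]; [split; [apply w_le_bp_le|apply bp_le_w_le]|].
    split; [intros []|]. intros (H & K & _ & _ & FG).
    destruct (FG (fun _ => 0) I) as (k & _ & [s Hs] & Back).
    destruct (Back s Hs) as (q & _ & []).
  - split; [intros _; apply bp_le_top|now destruct f].
Qed.

Lemma mv_r_baire_space (h : baire -> baire -> Prop) p q :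
  mv_r (Mvmap baire_space baire_space h) p q <-> h p q.
Proof.
  rewrite mv_r_iff. split; [intros (x & y & <- & H & <-); exact H|].
  intros H. exists p, q. repeat split. exact H.
Qed.

Lemma completion_rep_total (X : repspace) p : exists z : completion X, rep p z.
Proof.
  destruct (classic (exists x, precomp_rep X p x)) as [[x Hx]|N].
  - now exists (Some x).
  - now exists None.
Qed.

Lemma mv_r_completion (f : mvmap) p s :
  mv_r (mv_completion f) p s <->
  forall u, dec p u -> mdom (mv_r f) u -> exists v, dec s v /\ mv_r f u v.
Proof.
  rewrite mv_r_iff. setoid_rewrite mdom_mv_r. setoid_rewrite mv_r_iff. split.
  - intros (a & b & Ha & Hf & Hb) u Hu (x & Hx & Dx).
    assert (a = Some x) as ->.
    { apply (rep_functional (completion (src f)) p); [exact Ha|now exists u]. }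
    destruct Hf as [(x' & y & [= <-] & -> & Hf)|N]; [|exfalso; eauto].
    destruct Hb as (v & Hv & Hy). eauto 8.
  - intros H. destruct (completion_rep_total (src f) p) as [a Ha].
    destruct (completion_rep_total (tgt f) s) as [b Hb].
    destruct (classic (exists x, a = Some x /\ mdom f x)) as [(x & -> & Dx)|N].
    + destruct Ha as (u & Hu & Hx).
      destruct (H u Hu) as (v & Hv & x' & y & Hx' & Hf & Hy); [eauto|].
      rewrite (rep_functional _ _ _ _ Hx' Hx) in Hf.
      exists (Some x), (Some y). split; [now exists u|]. split; [|now exists v].
      left. eauto.
    + exists a, b. split; [assumption|]. split; [now right|assumption].
Qed.

Lemma mv_r_parallel (f : mvmap) p s :
  mv_r (mv_parallel f) p s <-> forall i, mv_r f (sproj i p) (sproj i s).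
Proof.
  rewrite mv_r_iff. setoid_rewrite mv_r_iff. split.
  - intros (x & y & Hx & Hf & Hy) i. exists (x i), (y i). auto.
  - intros H. apply choice in H as [x H]. apply choice in H as [y H].
    exists x, y. repeat split; intros i; apply H.
Qed.

Lemma mdom_mv_r_completion (f : mvmap) p : mdom (mv_r (mv_completion f)) p.
Proof.
  destruct (classic (exists u, dec p u /\ mdom (mv_r f) u)) as [(u & Hu & v & Hv)|N].
  - exists (fun j => S (v j)). apply mv_r_completion. intros u' Hu' _.
    rewrite (dec_functional _ _ _ Hu' Hu). exists v. auto using dec_succ.
  - exists p. apply mv_r_completion. intros u Hu Du. exfalso. eauto.
Qed.

Lemma mdom_mv_r_parallel (f : mvmap) p :
  (forall i, mdom (mv_r f) (sproj i p)) -> mdom (mv_r (mv_parallel f)) p.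
Proof.
  intros H. apply choice in H as [s Hs].
  exists (stuple s). apply mv_r_parallel. intros i. rewrite sproj_stuple. apply Hs.
Qed.

Lemma problem_on_names_pt (f : mvmap) :
  problem_on_names (p_pt (Prob f)) = bp_pt (problem_on_names (Prob f)).
Proof.
  apply bproblem_ext; simpl.
  - intros p. split; [trivial|intros _].
    apply mdom_mv_r_parallel. intros i. apply mdom_mv_r_completion.
  - intros p s. rewrite mv_r_parallel. setoid_rewrite mv_r_completion. reflexivity.
Qed.

Lemma ptw_le_iff f g :
  ptw_le f g <-> bp_ptw_le (problem_on_names f) (problem_on_names g).
Proof.
  unfold ptw_le, bp_ptw_le. rewrite w_le_iff. destruct g as [g|].
  - now rewrite problem_on_names_pt.
  - split; intros _; [|apply bp_le_top].
    exact (bp_ptw_le_trans _ _ _ (bp_le_ptw_le _ _ (bp_le_top _)) (bp_ptw_le_refl _)).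
Qed.

Lemma ptw_le_refl f : ptw_le f f.
Proof. apply ptw_le_iff, bp_ptw_le_refl. Qed.

Lemma ptw_le_trans f g h : ptw_le f g -> ptw_le g h -> ptw_le f h.
Proof. rewrite !ptw_le_iff. apply bp_ptw_le_trans. Qed.

Lemma mv_r_sup (f g : mvmap) p s :
  mv_r (mv_sup f g) p s <->
  p 0 = 0 /\ s 0 = 0 /\ mv_r f (stail p) (stail s) \/
  p 0 = 1 /\ s 0 = 1 /\ mv_r g (stail p) (stail s).
Proof.
  rewrite !mv_r_iff. split.
  - intros ([x|x] & [y|y] & [Hp Hx] & Hf & [Hs Hy]);
      [left|destruct Hf|destruct Hf|right];
      repeat (split; [assumption|]); now exists x, y.
  - intros [(Hp & Hs & x & y & Hx & Hf & Hy)|(Hp & Hs & x & y & Hx & Hf & Hy)].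
    + now exists (inl x), (inl y).
    + now exists (inr x), (inr y).
Qed.

Lemma problem_on_names_mv_sup (f g : mvmap) :
  problem_on_names (Prob (mv_sup f g)) =
  bp_sup (problem_on_names (Prob f)) (problem_on_names (Prob g)).
Proof.
  apply bproblem_ext; [intros p; split|intros p s; apply mv_r_sup].
  - intros [s Hs]. apply mv_r_sup in Hs as [(Hp & _ & Hs)|(Hp & _ & Hs)].
    + left. split; [assumption|now exists (stail s)].
    + right. split; [assumption|now exists (stail s)].
  - intros [[Hp [s Hs]]|[Hp [s Hs]]].
    + exists (scons 0 s). apply mv_r_sup. now left.
    + exists (scons 1 s). apply mv_r_sup. now right.
Qed.

Lemma bp_sup_problem_on_names f g :
  bp_equiv (bp_sup (problem_on_names f) (problem_on_names g))
    (problem_on_names (p_sup f g)).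
Proof.
  destruct f as [f|]; [|apply bp_sup_top_l].
  destruct g as [g|]; [|apply bp_sup_top_r].
  change (p_sup (Prob f) (Prob g)) with (Prob (mv_sup f g)).
  rewrite problem_on_names_mv_sup. split; apply bp_le_refl.
Qed.

Lemma mv_r_inf (f g : mvmap) p s :
  mv_r (mv_inf f g) p s <->
  mdom (mv_r f) (sfst p) /\ mdom (mv_r g) (ssnd p) /\
  (s 0 = 0 /\ mv_r f (sfst p) (stail s) \/ s 0 = 1 /\ mv_r g (ssnd p) (stail s)).
Proof.
  rewrite !mdom_mv_r, !mv_r_iff. split.
  - intros ([x u] & [y|y] & [Hx Hu] & (Dx & Du & Hf) & [Hs Hy]); simpl in *.
    + split; [eauto|]. split; [eauto|]. left. eauto 6.
    + split; [eauto|]. split; [eauto|]. right. eauto 6.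
  - intros ((x & Hx & Dx) & (u & Hu & Du) & [[Hs H]|[Hs H]]);
      destruct H as (z & y & Hz & Hf & Hy).
    + rewrite (rep_functional _ _ _ _ Hz Hx) in Hf. now exists (x, u), (inl y).
    + rewrite (rep_functional _ _ _ _ Hz Hu) in Hf. now exists (x, u), (inr y).
Qed.

Lemma problem_on_names_mv_inf (f g : mvmap) :
  problem_on_names (Prob (mv_inf f g)) =
  bp_inf (problem_on_names (Prob f)) (problem_on_names (Prob g)).
Proof.
  apply bproblem_ext; [intros p; split|intros p s; apply mv_r_inf].
  - intros [s Hs]. apply mv_r_inf in Hs as (Df & Dg & _). now split.
  - intros [[s Hs] Dg]. exists (scons 0 s). apply mv_r_inf.
    split; [now exists s|]. split; [assumption|now left].
Qed.

Lemma bp_inf_problem_on_names f g :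
  bp_equiv (bp_inf (problem_on_names f) (problem_on_names g))
    (problem_on_names (p_inf f g)).
Proof.
  destruct f as [f|]; [|apply bp_inf_top_l].
  destruct g as [g|]; [|apply bp_inf_top_r].
  change (p_inf (Prob f) (Prob g)) with (Prob (mv_inf f g)).
  rewrite problem_on_names_mv_inf. split; apply bp_le_refl.
Qed.

Definition mv_const (A : baire -> Prop) : mvmap :=
  Mvmap baire_space baire_space (fun _ q => A q).

Lemma p_const_nonempty (A : baire -> Prop) :
  (exists q, A q) -> p_const A = Prob (mv_const A).
Proof. intros H. unfold p_const. now destruct (excluded_middle_informative _). Qed.

Lemma p_const_empty (A : baire -> Prop) : ~ (exists q, A q) -> p_const A = Top.
Proof. intros H. unfold p_const. now destruct (excluded_middle_informative _). Qed.

Lemma problem_on_names_const A : problem_on_names (p_const A) = bp_const A.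
Proof.
  destruct (classic (exists a, A a)) as [[a Ha]|N].
  - rewrite p_const_nonempty by now exists a. apply bproblem_ext; simpl.
    + intros p. split; [trivial|intros _]. exists a. now apply mv_r_baire_space.
    + intros p q. apply (mv_r_baire_space (fun _ q => A q)).
  - rewrite (p_const_empty A N). apply bproblem_ext; simpl; [reflexivity|].
    split; [easy|eauto].
Qed.

Lemma encodes_pt_const A : encodes (problem_on_names (p_pt (p_const A))) A.
Proof.
  pose proof (problem_on_names_const A) as E.
  destruct (classic (exists a, A a)) as [HA|N].
  - rewrite p_const_nonempty in * by assumption.
    rewrite problem_on_names_pt, E. apply encodes_bp_pt_const.
  - rewrite (p_const_empty A N). split; simpl; [trivial|eauto|easy].
Qed.

(** * Implication *)

Lemma mcomp_nonempty_sub_functional_l {X Y Z : Type}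
  (g : Y -> Z -> Prop) (f : X -> Y -> Prop) x (Q : Z -> Prop) :
  (forall y z z', g y z -> g y z' -> z = z') ->
  mdom (mcomp g f) x /\ (forall z, mcomp g f x z -> Q z) <->
  mdom f x /\ forall y, f x y -> exists z, g y z /\ Q z.
Proof.
  intros functional. unfold mcomp. split.
  - intros [[z0 [Total (y0 & Hy0 & _)]] Sound]. split; [now exists y0|].
    intros y Hy. destruct (Total y Hy) as [z Hz]. eauto 7.
  - intros [[y0 Hy0] H].
    assert (Total : forall y, f x y -> mdom g y).
    { intros y Hy. destruct (H y Hy) as (z & Hz & _). now exists z. }
    split.
    + destruct (Total y0 Hy0) as [z Hz]. exists z. eauto.
    + intros z (_ & y & Hy & Hz). destruct (H y Hy) as (z' & Hz' & Qz').
      now rewrite (functional y z z').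
Qed.

Lemma mcomp_nonempty_sub_functional_r {X Y Z : Type}
  (g : Y -> Z -> Prop) (f : X -> Y -> Prop) x (Q : Z -> Prop) :
  (forall y y', f x y -> f x y' -> y = y') ->
  mdom (mcomp g f) x /\ (forall z, mcomp g f x z -> Q z) <->
  exists y, f x y /\ mdom g y /\ forall z, g y z -> Q z.
Proof.
  intros functional. unfold mcomp. split.
  - intros [(z0 & Dom & y & Hy & Hz0) HQ]. exists y. split; [assumption|].
    split; [now exists z0|]. intros z Hz. apply HQ. eauto.
  - intros (y & Hy & [z0 Hz0] & HQ).
    assert (Dom : forall y', f x y' -> mdom g y').
    { intros y' Hy'. rewrite (functional y' y) by assumption. now exists z0. }
    split; [exists z0; eauto|]. intros z (_ & y' & Hy' & Hz).
    apply HQ. now rewrite (functional y y').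
Qed.

(* The triples [<n, k, q>] that reduce [f] to [g] at [p]: [k] produces the query,
   and [n] translates its answers with the help of [q]. *)
Lemma mv_mimp_iff (phi : nat -> pfun) (g f : mvmap) p n k q :
  mv_mimp phi g f p (scons n (scons k q)) <->
  exists r, phi k p r /\ mdom (mv_r g) r /\
    forall t, mv_r g r t -> exists s, phi n (spair q t) s /\ mv_r f p s.
Proof.
  rewrite <- mcomp_nonempty_sub_functional_r by apply graph_functional.
  rewrite <- (mcomp_nonempty_sub_functional_l (fun t s => phi n (spair q t) s)) by
    (intros t; apply graph_functional).
  split.
  - intros (n' & k' & q' & E & H).
    assert (n' = n) as -> by exact (f_equal (fun t => t 0) (eq_sym E)).
    assert (k' = k) as -> by exact (f_equal (fun t => t 1) (eq_sym E)).
    assert (q' = q) as -> by exact (f_equal (fun t => stail (stail t)) (eq_sym E)).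
    exact H.
  - intros H. now exists n, k, q.
Qed.

Section Implication.

Variable phi : nat -> pfun.
Hypothesis Hphi : goedel_numbering phi.

Lemma goedel_index R :
  computable_rel R -> exists n, forall p q, R p q -> phi n p q.
Proof.
  intros [e He]. destruct (gn_complete _ Hphi e) as [n Hn].
  exists n. intros p q H. apply Hn, He, H.
Qed.

Lemma computable_rel_goedel N Phi :
  computable_op (fun p _ => N p) -> computable_op Phi ->
  computable_rel (fun p q => phi (N p) (Phi p) q).
Proof.
  intros CN CPhi. destruct (gn_utm _ Hphi) as [u Hu].
  destruct (computable_rel_precomp (fun p => scons (N p) (Phi p)) (computed u))
    as [e He]; [computability|now exists u|].
  exists e. intros p q H. now apply He, Hu.
Qed.

#[local] Hint Resolve computable_rel_goedel : computability.

Lemma med_imp_nonempty (A B : baire -> Prop) :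
  (exists a, A a) -> exists r, med_imp phi B A r.
Proof.
  intros [a Ha].
  destruct (goedel_index (fun p q => q = sfst p)) as [n Hn]; [computability|].
  exists (scons n a), n, a. split; [reflexivity|].
  intros p _. exists a. split; [|assumption]. apply Hn. now rewrite sfst_spair.
Qed.

Variables (g f : mvmap) (B A : baire -> Prop).
Hypothesis gB : encodes (problem_on_names (Prob g)) B.
Hypothesis fA : encodes (problem_on_names (Prob f)) A.

Lemma mv_mimp_of_med_imp :
  exists n k, forall p r, med_imp phi B A r ->
    mv_mimp phi g f p (scons n (scons k r)).
Proof.
  destruct (goedel_index (fun _ q => q = ones)) as [k Hk]; [computability|].
  destruct (goedel_index (fun r q => exists b, dec (sproj 0 (ssnd r)) b /\
    exists a, phi (r 0) (spair (stail (sfst r)) b) a /\ q = const_name a))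
    as [n Hn]; [computability|].
  exists n, k. intros p r (m & q & -> & Hr). apply mv_mimp_iff.
  exists ones. split; [now apply Hk|]. split; [apply (encodes_total _ _ gB)|].
  intros t Ht. destruct (encodes_elim _ _ gB t Ht) as (b & Hb & Bb).
  destruct (Hr b Bb) as (a & Ha & Aa). exists (const_name a).
  split; [|now apply (encodes_intro _ _ fA)].
  apply Hn. rewrite sfst_spair, ssnd_spair. eauto.
Qed.

Lemma med_imp_of_mv_mimp :
  exists n, forall t, mv_mimp phi g f ones t -> med_imp phi B A (scons n t).
Proof.
  destruct (goedel_index (fun r q =>
    exists s, phi (r 0) (spair (stail (stail (sfst r))) (const_name (ssnd r))) s /\
      dec (sproj 0 s) q)) as [n Hn]; [computability|].
  exists n. intros t Ht. exists n, t. split; [reflexivity|].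
  destruct Ht as (m & k & q & -> & Ht).
  assert (Hmkq : mv_mimp phi g f ones (scons m (scons k q))) by now exists m, k, q.
  apply mv_mimp_iff in Hmkq as (r & _ & _ & Back). intros b Bb.
  destruct (Back (const_name b)) as (s & Hs & Fs);
    [now apply (encodes_intro _ _ gB)|].
  destruct (encodes_elim _ _ fA s Fs) as (a & Da & Aa).
  exists a. split; [|assumption]. apply Hn. rewrite sfst_spair, ssnd_spair. eauto.
Qed.

Lemma bp_const_imp :
  (exists a, A a) ->
  bp_ptw_equiv (bp_const (med_imp phi B A))
    (problem_on_names (Prob (mv_mimp phi g f))).
Proof.
  intros HA. destruct mv_mimp_of_med_imp as (n & k & Hnk). split.
  - destruct med_imp_of_mv_mimp as [m Hm].
    apply bp_le_ptw_le, bp_const_le with (fun t q => q = scons m t) ones.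
    + computability.
    + computability.
    + destruct (med_imp_nonempty A B HA) as [r Hr].
      exists (scons n (scons k r)). apply mv_r_baire_space. now apply Hnk.
    + intros t Ht. apply (mv_r_baire_space (mv_mimp phi g f)) in Ht.
      exists (scons m t). split; [reflexivity|]. now apply Hm.
  - apply bp_ptw_le_const with (fun r q => q = scons n (scons k (ssnd r))).
    + computability.
    + intros p r _ Hr. rewrite ssnd_spair. eexists. split; [reflexivity|].
      apply mv_r_baire_space. now apply Hnk.
Qed.

End Implication.

(** * Degrees *)

Section Degrees.

Context {T : Type} (le : T -> T -> Prop).
Hypothesis le_refl : forall a, le a a.
Hypothesis le_trans : forall a b c, le a b -> le b c -> le a c.

Lemma degree_eq (d d' : degree le) : proj1_sig d = proj1_sig d' -> d = d'.
Proof.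
  destruct d as [D HD], d' as [D' HD']. simpl. intros ->. f_equal.
  apply proof_irrelevance.
Qed.

Lemma deg_eq a b : deg le a = deg le b <-> le a b /\ le b a.
Proof.
  split.
  - intros E. apply (f_equal (@proj1_sig _ _)) in E. simpl in E.
    change (deg_class le a b). rewrite E. split; apply le_refl.
  - intros [Hab Hba]. apply degree_eq. extensionality c.
    apply propositional_extensionality. simpl. unfold deg_class.
    split; intros []; split; eauto.
Qed.

Lemma deg_surjective (d : degree le) : exists a, d = deg le a.
Proof. destruct d as [D [a Ha]]. exists a. now apply degree_eq. Qed.

Lemma deg_lift {U : Type} (f : T -> U) :
  (forall a b, deg le a = deg le b -> f a = f b) ->
  exists c : degree le -> U, forall a, c (deg le a) = f a.
Proof.
  intros Hf. destruct (choice _ deg_surjective) as [r Hr].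
  exists (fun d => f (r d)). intros a. apply Hf. symmetry. apply Hr.
Qed.

End Degrees.

Lemma wdeg_eq f g :
  wdeg f = wdeg g <-> bp_ptw_equiv (problem_on_names f) (problem_on_names g).
Proof.
  unfold wdeg, bp_ptw_equiv. rewrite <- !ptw_le_iff.
  apply deg_eq; [exact ptw_le_refl|exact ptw_le_trans].
Qed.

Lemma mdeg_eq A B : mdeg A = mdeg B <-> med_le A B /\ med_le B A.
Proof. apply deg_eq; [exact med_le_refl|exact med_le_trans]. Qed.

Lemma wdeg_const_eq A B : wdeg (p_const A) = wdeg (p_const B) <-> mdeg A = mdeg B.
Proof.
  rewrite wdeg_eq, mdeg_eq, !problem_on_names_const, !med_le_bp_ptw_le. reflexivity.
Qed.

Lemma med_le_ptw_le A B : med_le A B <-> ptw_le (p_const A) (p_const B).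
Proof. rewrite ptw_le_iff, !problem_on_names_const. apply med_le_bp_ptw_le. Qed.

Lemma wdeg_const_otimes A B :
  wdeg (p_const (med_otimes A B)) = wdeg (ptw_inf (p_const A) (p_const B)).
Proof.
  apply wdeg_eq. rewrite problem_on_names_const.
  eapply bp_ptw_equiv_trans; [|apply bp_equiv_ptw_equiv, bp_inf_problem_on_names].
  apply bp_const_otimes; apply encodes_pt_const.
Qed.

Lemma wdeg_const_oplus A B :
  wdeg (p_const (med_oplus A B)) = wdeg (p_sup (p_const A) (p_const B)).
Proof.
  apply wdeg_eq. rewrite problem_on_names_const.
  eapply bp_ptw_equiv_trans; [|apply bp_equiv_ptw_equiv, bp_sup_problem_on_names].
  rewrite !problem_on_names_const. apply bp_const_oplus.
Qed.

Lemma wdeg_const_true_id : wdeg (p_const (fun _ => True)) = wdeg p_id.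
Proof.
  apply wdeg_eq. rewrite problem_on_names_const. split.
  - apply bp_le_ptw_le, bp_const_le with (fun s q => q = s) ones;
      [computability|computability| |eauto].
    exists ones. now apply mv_r_baire_space.
  - apply bp_ptw_le_const with (fun r q => q = sfst r); [computability|].
    intros p b _ _. exists p. rewrite sfst_spair. split; [reflexivity|].
    now apply mv_r_baire_space.
Qed.

Lemma wdeg_const_true_zero : wdeg (p_const (fun _ => True)) = wdeg p_zero.
Proof.
  apply wdeg_eq. rewrite problem_on_names_const. split.
  - apply bp_const_le with (fun s q => q = s) ones;
      [computability|computability|exact I|eauto].
  - apply bp_ptw_le_const with (fun r q => q = r); [computability|].
    intros p b [s Hs] _. now apply (mv_r_baire_space (fun _ _ => False)) in Hs.
Qed.

Lemma med_imp_empty phi (A B : baire -> Prop) :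
  ~ (exists b, B b) -> med_imp phi B A = fun _ => True.
Proof.
  intros HB. extensionality r. apply propositional_extensionality.
  split; [trivial|intros _]. exists (r 0), (stail r). split.
  - now extensionality i; destruct i.
  - intros p Hp. exfalso. eauto.
Qed.

Lemma wdeg_const_imp (phi : nat -> pfun) (Hphi : goedel_numbering phi) A B :
  wdeg (p_const (med_imp phi B A)) = wdeg (ptw_imp phi (p_const B) (p_const A)).
Proof.
  unfold ptw_imp. destruct (classic (exists b, B b)) as [HB|HB].
  2:{ rewrite med_imp_empty, (p_const_empty B HB) by assumption.
      apply wdeg_const_true_zero. }
  destruct (classic (exists a, A a)) as [HA|HA].
  2:{ rewrite (p_const_nonempty B HB), (p_const_empty A HA), p_const_empty;
        [reflexivity|].
      intros (r & n & q & _ & Hr). destruct HB as [b Hb].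
      destruct (Hr b Hb) as (s & _ & Hs). eauto. }
  pose proof (encodes_pt_const A) as EA. pose proof (encodes_pt_const B) as EB.
  rewrite (p_const_nonempty A HA) in *. rewrite (p_const_nonempty B HB) in *.
  simpl. destruct (excluded_middle_informative _) as [_|N].
  - apply wdeg_eq. rewrite problem_on_names_const. now apply bp_const_imp.
  - exfalso. apply N. left.
    destruct (proj1 (mdom_mv_r _ _) (encodes_total _ _ EB zeros)) as (u & _ & Du).
    eauto.
Qed.

Theorem theorem8p8 (phi : nat -> pfun) (Hphi : goedel_numbering phi) :
  exists c : mdegree -> wdegree,
    (forall A : baire -> Prop, c (mdeg A) = wdeg (p_const A)) /\
    (forall a b : mdegree, c a = c b -> a = b) /\
    (forall A B : baire -> Prop,
       med_le A B <-> ptw_le (p_const A) (p_const B)) /\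
    (forall A B : baire -> Prop,
       c (mdeg (med_otimes A B)) = wdeg (ptw_inf (p_const A) (p_const B))) /\
    (forall A B : baire -> Prop,
       c (mdeg (med_oplus A B)) = wdeg (p_sup (p_const A) (p_const B))) /\
    (forall A B : baire -> Prop,
       c (mdeg (med_imp phi B A)) =
         wdeg (ptw_imp phi (p_const B) (p_const A))) /\
    c (mdeg (fun _ => True)) = wdeg p_id /\
    c (mdeg (fun _ => False)) = wdeg Top.
Proof.
  destruct (deg_lift med_le (fun A => wdeg (p_const A))) as [c Hc].
  { intros A B. apply wdeg_const_eq. }
  exists c. split; [exact Hc|]. split; [|split; [exact med_le_ptw_le|]].
  - intros a b.
    destruct (deg_surjective _ a) as [A ->], (deg_surjective _ b) as [B ->].
    rewrite !Hc. apply wdeg_const_eq.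
  - unfold mdeg. setoid_rewrite Hc.
    split; [exact wdeg_const_otimes|]. split; [exact wdeg_const_oplus|].
    split; [exact (wdeg_const_imp phi Hphi)|]. split; [exact wdeg_const_true_id|].
    rewrite p_const_empty; [reflexivity|]. now intros [q []].
Qed.
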